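(* There is a well-defined map $\mu:\mathcal{K}(\mathcal{A})\to\mathcal{K}(T^2)$ from the set of annular multi-knotoids to the set of toroidal multi-knotoids, induced by the inclusion of the annulus in the torus, which is not injective. Similarly, there is a well-defined map $\mu:\mathcal{K}(\mathcal{A}\times I)\to\mathcal{K}(T^2\times I)$ from the set of multi-knotoids in the thickened annulus to the set of multi-knotoids in the thickened torus, induced by the inclusion of the thickened annulus in the thickened torus, which is not injective.
   Context: For an oriented surface $\Sigma$, a multi-knotoid diagram in $\Sigma$ is a generic smooth immersion of one interval $[0,1]$ and finitely many (possibly zero) circles in the interior of $\Sigma$ whose only singularities are transversal double points (crossings) with over/under information; the images of $0$ and $1$ (leg and head) are distinct from each other and from the crossings. $\mathcal{K}(\Sigma)$ is the set of equivalence classes of such diagrams under surface isotopies of $\Sigma$ and Reidemeister moves R1, R2, R3 performed away from the endpoints (moving a strand over or under an endpoint is forbidden). With $I=[0,1]$, a multi-knotoid in $\Sigma\times I$ consists of two disjoint segments $L$ and $H$ (rails), each of the form $\{\text{point}\}\times I$ with the point in the interior of $\Sigma$, together with an open embedded curve with its leg on $L$ and its head on $H$ and otherwise disjoint from the rails, and finitely many disjoint embedded closed curves, disjoint from the rails and the open curve; all curves lie in the interior of $\Sigma\times I$, except that the endpoints may lie in the interiors of $\Sigma\times\{0\}$ and $\Sigma\times\{1\}$. Rail isotopy is generated by ambient isotopies of $\Sigma\times I$ taking place in its interior and in the complement of the rails, keeping the endpoints attached to their rails but allowing them to slide along them, and shifts of the rails up to isotopy (a rail may not cross an arc of the curves).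 $\mathcal{K}(\Sigma\times I)$ is the set of rail isotopy classes. $\mathcal{A}=S^1\times D^1$ is the annulus, included in the torus $T^2$ by identifying (the interior of) $\mathcal{A}$ with the complement of a longitudinal circle in $T^2$; the thickened inclusion is the product of this with $I$. *)

(* Defs.v *)
(* Submanifolds are subsets of a Euclidean space, given as a
   product of copies of R (as in S^1 x S^1 inside R^2 x R^2), and curves are
   functions of a real parameter. *)
From Stdlib Require Import Relation_Operators.
From mathcomp Require Import all_boot all_order all_algebra.
From mathcomp Require Import all_classical all_reals all_analysis.

Set Implicit Arguments.
Unset Strict Implicit.
Unset Printing Implicit Defensive.

Import Order.TTheory GRing.Theory Num.Theory.
Import numFieldNormedType.Exports.

Local Open Scope classical_set_scope.
Local Open Scope ring_scope.

(* A surface with its manifold interior: [inner] is [body] minus the boundary. *)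
Record surface (R : realType) (V : normedModType R) := Surface {
  body : set V;
  inner : set V }.

Definition annulus (R : realType) : surface (R * R * R)%type := {|
  body := [set x : R * R * R | x.1.1 ^+ 2 + x.1.2 ^+ 2 = 1 /\ -1 <= x.2 <= 1];
  inner := [set x : R * R * R | x.1.1 ^+ 2 + x.1.2 ^+ 2 = 1 /\ -1 < x.2 < 1] |}.

Definition torus (R : realType) : surface ((R * R) * (R * R))%type :=
  let T := [set x : (R * R) * (R * R) |
              x.1.1 ^+ 2 + x.1.2 ^+ 2 = 1 /\ x.2.1 ^+ 2 + x.2.2 ^+ 2 = 1] in
  {| body := T; inner := T |}.

(* (z, t) |-> (z, exp (i pi t)): it maps the interior of the annulus
   homeomorphically onto the complement of the longitude S^1 x {-1}. *)
Definition inclusion (R : realType) (x : R * R * R) : (R * R) * (R * R) :=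
  (x.1, (cos (pi * x.2), sin (pi * x.2))).

Definition thick_inclusion (R : realType) (x : (R * R * R) * R) :
    ((R * R) * (R * R)) * R :=
  (inclusion x.1, x.2).

(* Ambient isotopies are topological.  [Y] is a subset of [X] respected by the
   isotopy; it is used to keep the boundary of a surface invariant (which is
   automatic for a surface, and rules out pushing corners for [body S x I]). *)
Definition isotopy (R : realType) (W : normedModType R) (X Y : set W)
    (h : R -> W -> W) : Prop :=
  (forall x, X x -> h 0 x = x) /\
  exists g : R -> W -> W,
    [/\ {within [set p : R * W | 0 <= p.1 <= 1 /\ X p.2],
           continuous (fun p : R * W => h p.1 p.2)},
        {within [set p : R * W | 0 <= p.1 <= 1 /\ X p.2],
           continuous (fun p : R * W => g p.1 p.2)}
      & forall t, 0 <= t <= 1 ->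
          [/\ forall x, X x -> X (h t x) /\ g t (h t x) = x,
              forall x, X x -> X (g t x) /\ h t (g t x) = x,
              forall x, Y x -> Y (h t x)
            & forall x, Y x -> Y (g t x)]].

(* One open curve (index [None], parameter in [0, 1]) and [ncirc] closed curves
   (indices [Some i], parameter in R modulo 1).  A smooth curve on [0, 1] is
   presented as the restriction of a smooth curve on R, whose values outside
   [0, 1] are irrelevant. *)
Record curves (R : realType) (W : normedModType R) := Curves {
  ncirc : nat;
  crv : option 'I_ncirc -> R -> W }.
Arguments crv {R W} c _ _.

Definition param (R : realType) (k : nat) : Type := (option 'I_k * R)%type.

Definition pdom (R : realType) (k : nat) (x : param R k) : Prop :=
  if x.1 is None then 0 <= x.2 <= 1 else True.

Definition psame (R : realType) (k : nat) (x y : param R k) : Prop :=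
  x.1 = y.1 /\
  if x.1 is None then x.2 = y.2 else exists z : int, x.2 - y.2 = z%:~R.

Definition pend (R : realType) (k : nat) (x : param R k) : Prop :=
  x = (None, 0) \/ x = (None, 1).

Definition pt (R : realType) (W : normedModType R) (C : curves W)
    (x : param R (ncirc C)) : W := crv C x.1 x.2.

Definition map_curves (R : realType) (W W' : normedModType R) (F : W -> W')
    (C : curves W) : curves W' :=
  {| crv := fun (i : option 'I_(ncirc C)) t => F (crv C i t) |}.

Definition smooth (R : realType) (W : normedModType R) (c : R -> W) : Prop :=
  forall n t, derivable (derive1n n c) t 1.

Definition immersed (R : realType) (W : normedModType R) (C : curves W) : Prop :=
  [/\ forall i : option 'I_(ncirc C), smooth (crv C i),
      forall x : param R (ncirc C), pdom x -> derive1 (crv C x.1) x.2 != 0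
    & forall (i : 'I_(ncirc C)) t, crv C (Some i) (t + 1) = crv C (Some i) t].

(* Homeomorphisms from [0, 1] plus k circles to [0, 1] plus k' circles that
   respect the orientation of the interval; the circles are unoriented. *)
Definition reparam (R : realType) (k k' : nat)
    (s : option 'I_k -> option 'I_k') (f : option 'I_k -> R -> R) : Prop :=
  [/\ bijective s /\ s None = None,
      forall i, continuous (f i) /\ injective (f i),
      f None 0 = 0 /\ f None 1 = 1
    & forall i : 'I_k, exists b : bool,
        forall t, f (Some i) (t + 1) = f (Some i) t + (-1) ^+ b].

Definition preparam (R : realType) (k k' : nat)
    (s : option 'I_k -> option 'I_k') (f : option 'I_k -> R -> R)
    (x : param R k) : param R k' := (s x.1, f x.1 x.2).

Definition classes (T : Type) (e : T -> T -> Prop) : Type :=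
  {C : set T | exists x, C = [set y | clos_refl_sym_trans T e x y]}.

Definition class_of (T : Type) (e : T -> T -> Prop) (x : T) : classes e :=
  exist _ [set y | clos_refl_sym_trans T e x y] (ex_intro _ x erefl).

(* [over i t] says whether the strand passing at parameter (i, t) is the upper
   one; it is meaningful only at the two parameters of a crossing. *)
Record prediagram (R : realType) (V : normedModType R) := PreDiagram {
  dcrv : curves V;
  over : option 'I_(ncirc dcrv) -> R -> bool }.
Arguments over {R V} p _ _.

Definition dparam (R : realType) (V : normedModType R) (D : prediagram V) : Type :=
  param R (ncirc (dcrv D)).

Definition dpt (R : realType) (V : normedModType R) (D : prediagram V)
    (x : dparam D) : V := pt x.
Arguments dpt {R V} D x.

Definition dover (R : realType) (V : normedModType R) (D : prediagram V)
    (x : dparam D) : bool := over D x.1 x.2.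
Arguments dover {R V} D x.

Definition double_point (R : realType) (V : normedModType R) (D : prediagram V)
    (x y : dparam D) : Prop :=
  [/\ pdom x, pdom y, ~ psame x y & dpt D x = dpt D y].

Definition crossing (R : realType) (V : normedModType R) (D : prediagram V)
    (x : dparam D) : Prop := exists y, double_point x y.
Arguments crossing {R V} D x.

Definition is_diagram (R : realType) (V : normedModType R) (S : surface V)
    (D : prediagram V) : Prop :=
  [/\ immersed (dcrv D),
      forall x : dparam D, pdom x -> inner S (dpt D x),
      forall x y : dparam D, double_point x y ->
        [/\ ~ pend x,
            dover D y = ~~ dover D x
          & forall a b : R,
              a *: derive1 (crv (dcrv D) x.1) x.2 +
              b *: derive1 (crv (dcrv D) y.1) y.2 = 0 ->
              a = 0 /\ b = 0],
      forall x y z : dparam D,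
        double_point x y -> double_point x z -> psame y z
    & forall (i : 'I_(ncirc (dcrv D))) t,
        over D (Some i) (t + 1) = over D (Some i) t].

Definition diagram (R : realType) (V : normedModType R) (S : surface V) : Type :=
  {D : prediagram V | is_diagram S D}.

Definition map_diagram (R : realType) (V V' : normedModType R) (F : V -> V')
    (D : prediagram V) : prediagram V' :=
  {| dcrv := map_curves F (dcrv D); over := over D |}.

Definition isotopy_move (R : realType) (V : normedModType R) (S : surface V)
    (D D' : prediagram V) : Prop :=
  exists (h : R -> V -> V) s f,
    [/\ isotopy (body S) (inner S) h,
        reparam s f,
        forall x : dparam D, pdom x ->
          dpt D' (preparam s f x) = h 1 (dpt D x)
      & forall x : dparam D, crossing D x ->
          dover D' (preparam s f x) = dover D x].

(* [m] strands in the square [-1, 1]^2, each parametrized by [-1, 1]. *)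
Record tangle (R : realType) (m : nat) := Tangle {
  strand : 'I_m -> R -> R * R;
  tover : 'I_m -> R -> bool }.

Definition square {R : realType} : set (R * R) :=
  [set p | -1 <= p.1 <= 1 /\ -1 <= p.2 <= 1].

(* [D'] is obtained from [D] by replacing [T] with [T'] inside a disc [e square]
   of the surface that does not contain the endpoints.  [(comp j, a j)] is the
   part of [D] that runs along the j-th strand. *)
Definition tangle_move (R : realType) (m : nat) (T T' : tangle R m)
    (V : normedModType R) (S : surface V) (D D' : prediagram V) : Prop :=
  exists (e : R * R -> V) s f
         (comp : 'I_m -> option 'I_(ncirc (dcrv D))) (a : 'I_m -> R -> R),
    let x_ j u : dparam D := (comp j, a j u) in
    let disc := e @` square in
    [/\ [/\ {within square, continuous e},
            set_inj square e,
            disc `<=` inner S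
          & forall x : dparam D, pend x -> ~ disc (dpt D x)],
        reparam s f,
        [/\ forall j, {within `[-1, 1], continuous (a j)},
            forall j u, -1 <= u <= 1 -> pdom (x_ j u),
            forall j j' u u', -1 <= u <= 1 -> -1 <= u' <= 1 ->
              psame (x_ j u) (x_ j' u') -> j = j' /\ u = u'
          & forall x, pdom x -> disc (dpt D x) ->
              exists j u, -1 <= u <= 1 /\ psame x (x_ j u)],
        forall x : dparam D, pdom x -> ~ disc (dpt D x) ->
          dpt D' (preparam s f x) = dpt D x /\
          (crossing D x -> dover D' (preparam s f x) = dover D x)
      & forall j u, -1 <= u <= 1 ->
          [/\ dpt D (x_ j u) = e (strand T j u),
              crossing D (x_ j u) -> dover D (x_ j u) = tover T j u,
              dpt D' (preparam s f (x_ j u)) = e (strand T' j u)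
            & crossing D' (preparam s f (x_ j u)) ->
              dover D' (preparam s f (x_ j u)) = tover T' j u]].

Definition R1_flat (R : realType) : tangle R 1 := {|
  strand := fun _ u => (u, 0);
  tover := fun _ _ => false |}.

(* The only double point is at u = +-1/sqrt 2; [b] selects which of the two
   passages is the upper one.  The kink on the other side of the strand is
   obtained by reflecting the square. *)
Definition R1_kink (R : realType) (b : bool) : tangle R 1 := {|
  strand := fun _ u => (2 * u ^+ 3 - u, (1 - u ^+ 2) / 2);
  tover := fun _ u => b (+) (u < 0) |}.

Definition R2_apart (R : realType) : tangle R 2 := {|
  strand := fun j u => (u, if j == 0%N :> nat then 1 / 2 else - (1 / 2));
  tover := fun j _ => j == 0%N :> nat |}.

(* Strand 0 passes over strand 1 at u = +-1/sqrt 2. *)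
Definition R2_overlap (R : realType) : tangle R 2 := {|
  strand := fun j u =>
    (u, if j == 0%N :> nat then u ^+ 2 - 1 / 2 else 1 / 2 - u ^+ 2);
  tover := fun j _ => j == 0%N :> nat |}.

(* Strand 2 is the top strand, and strand 0 passes over strand 1 where they meet,
   that is at u = 0.  The disc carries no orientation, and every permutation of
   the three strands is induced by a homeomorphism of the picture, so this
   accounts for all the versions of the move. *)
Definition R3_tangle (R : realType) (b : bool) : tangle R 3 := {|
  strand := fun j u =>
    if j == 0%N :> nat then (u, u) else if j == 1%N :> nat then (u, - u)
    else (u, (-1) ^+ b * ((1 - u ^+ 2) / 2));
  tover := fun j u => (j == 2%N :> nat) || ((j == 0%N :> nat) && (u == 0)) |}.

Inductive diagram_move (R : realType) (V : normedModType R) (S : surface V)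
    (D D' : diagram S) : Prop :=
| Move_isotopy of isotopy_move S (sval D) (sval D')
| Move_R1 b of tangle_move (R1_flat R) (R1_kink R b) S (sval D) (sval D')
| Move_R2 of tangle_move (R2_apart R) (R2_overlap R) S (sval D) (sval D')
| Move_R3 of
    tangle_move (R3_tangle R false) (R3_tangle R true) S (sval D) (sval D').

Definition K_surface (R : realType) (V : normedModType R) (S : surface V) : Type :=
  classes (@diagram_move R V S).

Definition diagram_class (R : realType) (V : normedModType R) (S : surface V)
    (D : diagram S) : K_surface S := class_of (@diagram_move R V S) D.

Definition thick (R : realType) (V : normedModType R) (X : set V) : set (V * R) :=
  [set x | X x.1 /\ 0 <= x.2 <= 1].

Definition thick_interior (R : realType) (V : normedModType R) (S : surface V) :
    set (V * R) :=
  [set x | inner S x.1 /\ 0 < x.2 < 1].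

Definition rail (R : realType) (V : normedModType R) (p : V) : set (V * R) :=
  [set x | x.1 = p /\ 0 <= x.2 <= 1].

Record railed_curves (R : realType) (V : normedModType R) := RailedCurves {
  leg_pt : V;
  head_pt : V;
  kcrv : curves (V * R)%type }.

Definition kparam (R : realType) (V : normedModType R) (K : railed_curves V) :
    Type :=
  param R (ncirc (kcrv K)).

Definition kpt (R : realType) (V : normedModType R) (K : railed_curves V)
    (x : kparam K) : V * R := pt x.
Arguments kpt {R V} K x.

Definition is_multi_knotoid (R : realType) (V : normedModType R) (S : surface V)
    (K : railed_curves V) : Prop :=
  [/\ [/\ inner S (leg_pt K), inner S (head_pt K) & leg_pt K <> head_pt K],
      immersed (kcrv K),
      forall x y : kparam K,
        pdom x -> pdom y -> kpt K x = kpt K y -> psame x y,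
      rail (leg_pt K) (kpt K (None, 0)) /\ rail (head_pt K) (kpt K (None, 1))
    & forall x : kparam K, pdom x -> ~ pend x ->
        [/\ thick_interior S (kpt K x),
            ~ rail (leg_pt K) (kpt K x)
          & ~ rail (head_pt K) (kpt K x)]].

Definition multi_knotoid (R : realType) (V : normedModType R) (S : surface V) :
    Type :=
  {K : railed_curves V | is_multi_knotoid S K}.

Definition map_railed (R : realType) (V V' : normedModType R) (F : V -> V')
    (G : V * R -> V' * R) (K : railed_curves V) : railed_curves V' :=
  {| leg_pt := F (leg_pt K);
     head_pt := F (head_pt K);
     kcrv := map_curves G (kcrv K) |}.

(* The curves of [K'] are the images of the curves of [K] under [F]. *)
Definition carries (R : realType) (V : normedModType R) (F : V * R -> V * R)
    (K K' : railed_curves V) : Prop :=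
  exists s f, reparam s f /\
    forall x : kparam K, pdom x ->
      kpt K' (preparam s f x) = F (kpt K x).

(* The rails are preserved as sets, so that endpoints can slide along them. *)
Definition rail_fixing_isotopy (R : realType) (V : normedModType R)
    (S : surface V) (K K' : railed_curves V) : Prop :=
  exists h : R -> V * R -> V * R,
    [/\ isotopy (thick (body S)) (thick (inner S)) h,
        forall t x, 0 <= t <= 1 -> thick (body S) x -> ~ thick_interior S x ->
          h t x = x,
        forall t, 0 <= t <= 1 ->
          h t @` rail (leg_pt K) = rail (leg_pt K) /\
          h t @` rail (head_pt K) = rail (head_pt K),
        leg_pt K' = leg_pt K /\ head_pt K' = head_pt K
      & carries (h 1) K K'].

(* A homeomorphism cannot move a point off the boundary; this move slides
   endpoints lying on [body S x {0, 1}] along their rails into the interior. *)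
Definition endpoint_slide (R : realType) (V : normedModType R)
    (K K' : railed_curves V) : Prop :=
  exists f : R -> R,
    [/\ {within `[0, 1], continuous f},
        forall u v, 0 <= u -> u < v -> v <= 1 -> f u < f v,
        forall u, 0 <= u <= 1 -> 0 <= f u <= 1,
        leg_pt K' = leg_pt K /\ head_pt K' = head_pt K
      & carries (fun x => (x.1, f x.2)) K K'].

Definition rail_shift (R : realType) (V : normedModType R) (S : surface V)
    (K K' : railed_curves V) : Prop :=
  exists (h : R -> V * R -> V * R) (p q : R -> V),
    [/\ isotopy (thick (body S)) (thick (inner S)) h,
        forall t, 0 <= t <= 1 -> h t @` rail (leg_pt K) = rail (p t) /\
                                 h t @` rail (head_pt K) = rail (q t),
        leg_pt K' = p 1 /\ head_pt K' = q 1
      & carries (h 1) K K'].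

Inductive rail_move (R : realType) (V : normedModType R) (S : surface V)
    (K K' : multi_knotoid S) : Prop :=
| Move_rail_isotopy of rail_fixing_isotopy S (sval K) (sval K')
| Move_endpoint_slide of endpoint_slide (sval K) (sval K')
| Move_rail_shift of rail_shift S (sval K) (sval K').

Definition K_thick (R : realType) (V : normedModType R) (S : surface V) : Type :=
  classes (@rail_move R V S).

Definition knotoid_class (R : realType) (V : normedModType R) (S : surface V)
    (K : multi_knotoid S) : K_thick S := class_of (@rail_move R V S) K.

(* Main.v *)
(* Cut open along the longitude, the torus is the annulus with its two boundary
   circles glued, so an isotopy of the annulus descends to the torus once it is
   made the identity near the boundary; this is done by inserting a collar on
   which the motion of the boundary is damped.  Reidemeister moves are local and
   carry over directly.

   Neither map is injective: take a short radial arc and a core circle, the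
   circle lying on one side of the arc or on the other.  A half turn of the torus
   along the meridian exchanges the two pictures.  In the annulus, seen as a
   planar ring, they differ by the winding number of the circle around the leg,
   which no move can change because no strand may cross the leg. *)
From Stdlib Require Import Relation_Operators.
Require Import Defs.
From mathcomp Require Import all_boot all_order all_algebra.
From mathcomp Require Import all_classical all_reals all_analysis.
From mathcomp Require Import ring lra.

Set Implicit Arguments.
Unset Strict Implicit.
Unset Printing Implicit Defensive.

Import Order.TTheory GRing.Theory Num.Theory.
Import numFieldNormedType.Exports.

Local Open Scope ring_scope.
Local Open Scope classical_set_scope.

(** * Continuity on subsets *)

(** No degree theory is set up: winding number zero is expressed by the existence of a continuous
    periodic argument of the loop, and only the alternative zero or nonzero is ever used. This
    alternative does not see the orientation or the numbering of the circles, which the moves do not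
    record, and it is constant along homotopies in the punctured plane because it is an open
    condition whose negation is open too. Invariance thus reduces to producing, for each move, a
    homotopy of circle minus leg that avoids the origin. In the other half, the obstacle is that an
    isotopy may turn the two boundary circles independently although the torus glues them. There is
    room for a collar because the curves sweep out only a compact part of the interior. The annulus
    and the thickened annulus are treated at once, through an abstract coordinate across the
    annulus. That coordinate has period 2 in the torus, so a half turn shifts it by 1. The leg goes
    from -3/4 to 1/4, while the circle goes from 1/2 to 3/2, that is to -1/2: it jumps over the
    removed longitude to the other side of the leg. *)

Lemma within_comp (T U W : topologicalType) (A : set T) (B : set U)
    (f : T -> U) (g : U -> W) :
  (forall x, A x -> B (f x)) ->
  {within A, continuous f} -> {within B, continuous g} ->
  {within A, continuous (fun x => g (f x))}.
Proof.
move=> AB /subspace_continuousP cf /subspace_continuousP cg.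
apply/subspace_continuousP => x Ax.
move=> P /(cg _ (AB _ Ax)) gP.
have := cf _ Ax _ gP; rewrite /nbhs /= /within /=.
apply: filterS => y Py Ay; exact: (Py Ay (AB _ Ay)).
Qed.

Lemma within_pair (T U W : topologicalType) (A : set T) (f : T -> U) (g : T -> W) :
  {within A, continuous f} -> {within A, continuous g} ->
  {within A, continuous (fun x => (f x, g x))}.
Proof.
move=> /subspace_continuousP cf /subspace_continuousP cg.
apply/subspace_continuousP => x Ax; apply: cvg_pair; [exact: cf|exact: cg].
Qed.

Lemma within_eq (T U : topologicalType) (A : set T) (f g : T -> U) :
  (forall x, A x -> f x = g x) ->
  {within A, continuous f} -> {within A, continuous g}.
Proof.
move=> fg cf; apply: subspace_eq_continuous cf => x; rewrite inE => Ax.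
exact: fg.
Qed.

Lemma within_total (T U W : topologicalType) (B : set U) (f : T -> U) (g : U -> W) :
  (forall x, B (f x)) -> continuous f -> {within B, continuous g} ->
  continuous (fun x => g (f x)).
Proof.
move=> AB cf cg; apply/continuous_subspace_setT.
apply: (within_comp _ _ cg) => [x _|]; first exact: AB.
exact: continuous_subspaceT.
Qed.

(* A closed subset of the compact set [K] has a compact, hence closed, image. *)
Lemma within_quotient (T U W : topologicalType) (K : set T) (q : T -> U)
    (F : U -> W) :
  hausdorff_space U -> compact K -> {within K, continuous q} ->
  {within K, continuous (fun x => F (q x))} -> {within q @` K, continuous F}.
Proof.
move=> hU cK cq /continuous_closedP cFq.
apply/continuous_closedP => C cC; apply/closed_subspaceP.
have /closed_subspaceP[V cV VK] := cFq _ cC.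
exists (q @` (K `&` V)).
  apply: (compact_closed hU); apply: continuous_compact.
    by apply: continuous_subspaceW cq; exact: subIsetl.
  exact: compact_closedI.
apply/seteqP; split=> [u [[x [Kx Vx] <-] Kq]|u [/= Cx [x Kx xy]]].
  by split=> //; have [] : ((fun x => F (q x)) @^-1` C `&` K) x by rewrite -VK.
split; last by exists x.
exists x => //; split=> //.
suff [] : (V `&` K) x by [].
by rewrite VK; split=> //; move: Cx; rewrite -xy.
Qed.

(** Tube lemma: compactness of [K] turns the neighbourhoods of [x0] found for each [y] into a single
    one. *)
Lemma tube_positive (R : realType) (T U : topologicalType) (K : set U)
    (G : T * U -> R) (x0 : T) :
  compact K -> continuous G -> (forall y, K y -> 0 < G (x0, y)) ->
  \forall x \near x0, forall y, K y -> 0 < G (x, y).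
Proof.
move=> /compact_near_coveringP cK cG G0.
have := cK _ (nbhs x0) (fun x y => 0 < G (x, y)) _.
apply => y Ky.
have := cG (x0, y) [set r | 0 < r] (lt_nbhsr (G0 _ Ky)).
by case=> -[/= A B [Ax By] AB]; exists (B, A) => // -[y' x'] [/= *]; exact: (AB (x', y')).
Qed.

Lemma connected_clopen (R : realType) (A : set R) (x y : R) :
  open A -> open (~` A) -> A x -> A y.
Proof.
move=> oA oCA Ax.
have /connected_intervalP cR : is_interval [set: R] by [].
have cl : closed A by rewrite -openC.
have -> : A = setT by apply: cR => //; [exists x|exists A|exists A]; rewrite ?setTI.
by [].
Qed.

Lemma continuous_fst_comp (T U W : topologicalType) (f : T -> U * W) :
  continuous f -> continuous (fun x => (f x).1).
Proof.
by move=> cf x; apply: (cvg_comp f fst (cf x)); case: (f x) => *; exact: cvg_fst.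
Qed.

Lemma continuous_snd_comp (T U W : topologicalType) (f : T -> U * W) :
  continuous f -> continuous (fun x => (f x).2).
Proof.
by move=> cf x; apply: (cvg_comp f snd (cf x)); case: (f x) => *; exact: cvg_snd.
Qed.

Lemma continuous_pair (T U W : topologicalType) (f : T -> U) (g : T -> W) :
  continuous f -> continuous g -> continuous (fun x => (f x, g x)).
Proof. by move=> cf cg x; apply: cvg_pair; [exact: cf|exact: cg]. Qed.

Lemma continuous_after (T U W : topologicalType) (f : T -> U) (g : U -> W) :
  continuous g -> continuous f -> continuous (fun x => g (f x)).
Proof. by move=> cg cf x; apply: (cvg_comp f g (cf x)); exact: cg. Qed.

(** * Angle functions of planar loops *)

Lemma periodic_int (R : realType) (T : Type) (f : R -> T) :
  (forall t, f (t + 1) = f t) -> forall (z : int) t, f (t + z%:~R) = f t.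
Proof.
move=> fP; have fn n t : f (t + n%:R) = f t.
  by elim: n t => [|n IH] t; rewrite ?addr0// -natr1 addrA fP IH.
case=> n t; first exact: fn.
by rewrite NegzE mulrNz -[LHS](fn n.+1) subrK.
Qed.

Lemma fractional_part (R : realType) (t : R) :
  exists2 z : int, 0 <= t - z%:~R <= 1 & t = (t - z%:~R) + z%:~R.
Proof.
exists (Num.floor t); last by rewrite subrK.
have := floor_le_tmp t; have := lt_succ_floor t; rewrite intrD; lra.
Qed.

Lemma periodic_unit (R : realType) (T : Type) (f : R -> T) :
  (forall t, f (t + 1) = f t) -> forall t, exists2 t', 0 <= t' <= 1 & f t = f t'.
Proof.
move=> fP t; have [z z01 tE] := fractional_part t.
by exists (t - z%:~R) => //; rewrite [in LHS]tE periodic_int.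
Qed.

(** [phi] is a periodic argument of the loop [F]: the equation makes [F u] parallel to
    [(cos (phi u), sin (phi u))], and the inequality makes it a positive multiple. In particular [F]
    avoids the origin, and periodicity of [phi] says that its winding number about the origin is
    zero. *)
Definition angle_lifts (R : realType) (F : R -> R * R) : Prop :=
  exists phi : R -> R,
    [/\ continuous phi,
        forall u, phi (u + 1) = phi u,
        forall u, (F u).1 * sin (phi u) = (F u).2 * cos (phi u)
      & forall u, 0 < (F u).1 * cos (phi u) + (F u).2 * sin (phi u)].

(** A positive scalar product keeps the angle from [F u] to [G u] strictly between -pi/2 and pi/2.
    There it equals [atan (b / a)], with [a] the scalar product and [b] the determinant, so it is
    continuous and periodic and can be added to [phi]. *)
Lemma angle_lifts_close (R : realType) (F G : R -> R * R) :
  continuous F -> continuous G ->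
  (forall u, F (u + 1) = F u) -> (forall u, G (u + 1) = G u) ->
  (forall u, 0 < (F u).1 * (G u).1 + (F u).2 * (G u).2) ->
  angle_lifts F -> angle_lifts G.
Proof.
move=> cF cG pF pG FG [phi [cphi pphi tphi sphi]].
pose a u := (F u).1 * (G u).1 + (F u).2 * (G u).2.
pose b u := (F u).1 * (G u).2 - (F u).2 * (G u).1.
have cM (f g : R -> R) : continuous f -> continuous g ->
    continuous (fun u => f u * g u).
  by move=> cf cg u; apply: continuousM; [exact: cf|exact: cg].
have [cF1 cF2] := (continuous_fst_comp cF, continuous_snd_comp cF).
have [cG1 cG2] := (continuous_fst_comp cG, continuous_snd_comp cG).
have ca : continuous a by move=> u; apply: cvgD; exact: cM.
have cb : continuous b by move=> u; apply: cvgB; exact: cM.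
have cba : continuous (fun u => b u / a u).
  by apply: cM => // u; apply: cvgV; [rewrite gt_eqF ?FG|exact: ca].
exists (fun u => phi u + atan (b u / a u)); split.
- move=> u; apply: cvgD; first exact: cphi.
  exact: (continuous_after (@continuous_atan R) cba).
- by move=> u; rewrite pphi /b /a pF pG.
- move=> u; have au : 0 < a u by exact: FG.
  have cpos : 0 < cos (atan (b u / a u)).
    by apply: cos_gt0_pihalf; rewrite atan_gtNpi2 atan_ltpi2.
  have : tan (atan (b u / a u)) = b u / a u by exact: atanK.
  rewrite /tan sinD cosD.
  move: (sin (atan _)) (cos (atan _)) cpos (tphi u) (sphi u) => S C C0 tu su SC.
  have {}SC : S * a u = C * b u.
    have := SC; move/(congr1 (fun x => x * (C * a u))).
    have aN : a u != 0 by rewrite gt_eqF.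
    have CN : C != 0 by rewrite gt_eqF.
    have -> : S / C * (C * a u) = S * a u by field.
    by have -> : b u / a u * (C * a u) = C * b u by field.
  move: tu su SC au; rewrite /a /b.
  have := cos2Dsin2 (phi u).
  move: (F u) (G u) (sin (phi u)) (cos (phi u)) => -[f1 f2] [g1 g2] s c /= h1 h2 h3 h4 h5.
  set r := f1 * c + f2 * s in h3.
  (* [r] is the length of [F u]; [e1] and [e2] are its polar form. *)
  have e1 : f1 = r * c by rewrite /r; transitivity (f1 * (c^+2+s^+2) + s * (f2 * c - f1 * s)); [rewrite h1 h2; ring|ring].
  have e2 : f2 = r * s by rewrite /r; transitivity (f2 * (c^+2+s^+2) + c * (f1 * s - f2 * c)); [rewrite h1 h2; ring|ring].
  apply/eqP; rewrite -subr_eq0; apply/eqP.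
  have rN : r != 0 by rewrite gt_eqF.
  apply: (mulfI rN); rewrite mulr0.
  rewrite e1 e2 in h4; clearbody r.
  transitivity (S * (r * c * g1 + r * s * g2) - C * (r * c * g2 - r * s * g1)); first ring.
  by rewrite h4; ring.
- move=> u; have au : 0 < a u by exact: FG.
  have cpos : 0 < cos (atan (b u / a u)).
    by apply: cos_gt0_pihalf; rewrite atan_gtNpi2 atan_ltpi2.
  have : tan (atan (b u / a u)) = b u / a u by exact: atanK.
  rewrite /tan sinD cosD.
  move: (sin (atan _)) (cos (atan _)) cpos (tphi u) (sphi u) => S C C0 tu su SC.
  have {}SC : S = C * b u / a u.
    have := SC; move/(congr1 (fun x => x * C)).
    have CN : C != 0 by rewrite gt_eqF.
    by rewrite mulfVK// => ->; rewrite mulrC mulrA.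
  have aN : a u != 0 by rewrite gt_eqF.
  move: tu su SC au aN; rewrite /a /b.
  have := cos2Dsin2 (phi u).
  move: (F u) (G u) (sin (phi u)) (cos (phi u)) => -[f1 f2] [g1 g2] s c /= h1 h2 h3 h4 h5 h6.
  set r := f1 * c + f2 * s in h3.
  have e1 : f1 = r * c by rewrite /r; transitivity (f1 * (c^+2+s^+2) + s * (f2 * c - f1 * s)); [rewrite h1 h2; ring|ring].
  have e2 : f2 = r * s by rewrite /r; transitivity (f2 * (c^+2+s^+2) + c * (f1 * s - f2 * c)); [rewrite h1 h2; ring|ring].
  (* The sign is tested after multiplying by [r] and by the scalar product, both positive.
     Eliminating [S] leaves [C] times the sum of the squares of scalar product and determinant. *)
  rewrite -(pmulr_rgt0 _ h3) -(pmulr_rgt0 _ h5).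
  have -> : (f1 * g1 + f2 * g2) * (r * (g1 * (c * C - s * S) + g2 * (s * C + c * S))) =
    C * ((f1 * g1 + f2 * g2) ^+ 2 + (f1 * g2 - f2 * g1) ^+ 2).
    rewrite h4 e1 e2; clearbody r; field.
    by rewrite e1 e2 in h6.
  apply: mulr_gt0 => //; apply: ltr_wpDr; first exact: sqr_ge0.
  exact: exprn_gt0.
Qed.

(** By compactness of one period, loops at nearby parameters have positive scalar product for all
    [u] at once. This relation is symmetric, so the parameters whose loop has a periodic argument
    form an open set with open complement in the connected line. *)
Lemma angle_lifts_homotopy (R : realType) (H : R * R -> R * R) :
  continuous H -> (forall s u, H (s, u + 1) = H (s, u)) ->
  (forall s u, H (s, u) <> 0) ->
  forall s s', angle_lifts (fun u => H (s, u)) -> angle_lifts (fun u => H (s', u)).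
Proof.
move=> cH pH nH.
have cHs s : continuous (fun u => H (s, u)).
  by apply: continuous_after => //; apply: continuous_pair => u; [exact: cvg_cst|].
have close s0 : \forall s \near s0, forall u,
    0 < (H (s0, u)).1 * (H (s, u)).1 + (H (s0, u)).2 * (H (s, u)).2.
  have := @tube_positive R R R `[0, 1]
    (fun p => (H (s0, p.2)).1 * (H p).1 + (H (s0, p.2)).2 * (H p).2) s0
    (@segment_compact R 0 1).
  have c1 : continuous (fun p : R * R => H (s0, p.2)).
    by apply: (continuous_after (cHs s0)) => -[? ?]; exact: cvg_snd.
  have cM (f g : R * R -> R) : continuous f -> continuous g ->
      continuous (fun u => f u * g u).
    by move=> cf cg u; apply: continuousM; [exact: cf|exact: cg].
  have [c11 c12] := (continuous_fst_comp c1, continuous_snd_comp c1).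
  have [cH1 cH2] := (continuous_fst_comp cH, continuous_snd_comp cH).
  move=> tube; have : \forall s \near s0, forall u, u \in `[0, 1]%R ->
      0 < (H (s0, u)).1 * (H (s, u)).1 + (H (s0, u)).2 * (H (s, u)).2.
    apply: tube.
  - by move=> p; apply: cvgD; [exact: (cM _ _ c11 cH1 p)|exact: (cM _ _ c12 cH2 p)].
  - move=> u _ /=; have := nH s0 u; case: (H (s0, u)) => x y /= xy.
    rewrite lt_neqAle addr_ge0 -?expr2 ?sqr_ge0// andbT eq_sym.
    rewrite paddr_eq0 ?sqr_ge0// !sqrf_eq0; apply/andP => -[/eqP x0 /eqP y0].
    by apply: xy; rewrite x0 y0.
  apply: filterS => s Hs u /=.
  have [u' u01 Hu] := @periodic_unit R _ (fun u => (H (s0, u), H (s, u)))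
    (fun t => congr2 pair (pH s0 t) (pH s t)) u.
  by case: Hu => -> ->; apply: (Hs u'); rewrite /= in_itv.
have close' s0 : \forall s \near s0,
    angle_lifts (fun u => H (s0, u)) <-> angle_lifts (fun u => H (s, u)).
  apply: filterS (close s0) => s Hs; split; apply: angle_lifts_close => //.
  by move=> u; rewrite mulrC [X in _ + X]mulrC.
move=> s s'; apply: (@connected_clopen R [set s | angle_lifts (fun u => H (s, u))] s s').
- rewrite openE => s0 /= L; have := close' s0; apply: filterS => s1 [+ _]; exact.
- rewrite openE => s0 /= L; have := close' s0; apply: filterS => s1 [_ sL] /sL; exact: L.
Qed.

(** * Smooth curves *)

(** The quotients in [derivable] and [derive1] differ only by the factor 1 in [h *: 1]. Stated as a
    limit, differentiability passes to pairs and components by continuity alone. *)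
Lemma derivable_cvgP (R : realType) (V : normedModType R) (f : R -> V) (t : R) (l : V) :
  h^-1 *: (f (h *: 1 + t) - f t) @[h --> 0^'] --> l <->
  derivable f t 1 /\ derive1 f t = l.
Proof.
have E : (fun h : R => h^-1 *: (f (h *: 1 + t) - f t)) =
         (fun h : R => h^-1 *: (f (h + t) - f t)).
  by apply/funext => h; rewrite [h *: 1]mulr1.
split=> [fl|[+ <-]].
  split; first by apply/cvg_ex; exists l.
  by rewrite /derive1; apply/cvg_lim => //; rewrite -E.
by rewrite /derivable /= /derive1 -E.
Qed.

Lemma derive1_pair (R : realType) (V W : normedModType R) (f : R -> V) (g : R -> W) (t : R) :
  derivable f t 1 -> derivable g t 1 ->
  derivable (fun u => (f u, g u)) t 1 /\
  (fun u => (f u, g u))^`() t = (derive1 f t, derive1 g t).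
Proof.
move=> df dg; apply/derivable_cvgP.
have cf := (derivable_cvgP f t (derive1 f t)).2 (conj df erefl).
have cg := (derivable_cvgP g t (derive1 g t)).2 (conj dg erefl).
exact: (cvg_pair cf cg).
Qed.

Lemma derive1_fst (R : realType) (V W : normedModType R) (f : R -> V * W) (t : R) :
  derivable f t 1 ->
  derivable (fun u => (f u).1) t 1 /\ (fun u => (f u).1)^`() t = (derive1 f t).1.
Proof.
move=> df; apply/derivable_cvgP.
have cf := (derivable_cvgP f t (derive1 f t)).2 (conj df erefl).
apply: (cvg_comp _ fst cf).
by case: (derive1 f t) => *; exact: cvg_fst.
Qed.

Lemma derive1_snd (R : realType) (V W : normedModType R) (f : R -> V * W) (t : R) :
  derivable f t 1 ->
  derivable (fun u => (f u).2) t 1 /\ (fun u => (f u).2)^`() t = (derive1 f t).2.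
Proof.
move=> df; apply/derivable_cvgP.
have cf := (derivable_cvgP f t (derive1 f t)).2 (conj df erefl).
apply: (cvg_comp _ snd cf).
by case: (derive1 f t) => *; exact: cvg_snd.
Qed.

(** Derivatives are peeled off from the inside, so that closure under products, cosine and sine
    follows by induction from the first-order rules, without formulas for higher derivatives. *)
Fixpoint differentiable_upto (R : realType) (V : normedModType R) (n : nat)
    (f : R -> V) : Prop :=
  if n is m.+1 then (forall t, derivable f t 1) /\ differentiable_upto m (derive1 f)
  else True.

Lemma smoothP (R : realType) (V : normedModType R) (f : R -> V) :
  smooth f <-> forall n, differentiable_upto n f.
Proof.
split=> [sf n|df n].
  elim: n f sf => //= n IH f sf; split; first exact: (sf 0%N).
  by apply: IH => k t; rewrite -derive1Sn; exact: sf.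
elim: n f df => [|n IH] f df t; first exact: (df 1%N).1.
by rewrite derive1Sn; apply: IH => k; exact: (df k.+1).2.
Qed.

Lemma differentiable_uptoW (R : realType) (V : normedModType R) n (f : R -> V) :
  differentiable_upto n.+1 f -> differentiable_upto n f.
Proof. by elim: n f => //= n IH f [df d2]; split=> //; exact: IH. Qed.

Lemma differentiable_upto_pair (R : realType) (V W : normedModType R) n
    (f : R -> V) (g : R -> W) :
  differentiable_upto n f -> differentiable_upto n g ->
  differentiable_upto n (fun u => (f u, g u)).
Proof.
elim: n f g => //= n IH f g [df df'] [dg dg']; split.
  by move=> t; have [] := derive1_pair (df t) (dg t).
suff -> : (fun u => (f u, g u))^`() = (fun u => (derive1 f u, derive1 g u)) by exact: IH.
by apply/funext => t; have [] := derive1_pair (df t) (dg t).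
Qed.

Lemma differentiable_upto_fst (R : realType) (V W : normedModType R) n
    (f : R -> V * W) :
  differentiable_upto n f -> differentiable_upto n (fun u => (f u).1).
Proof.
elim: n f => //= n IH f [df df']; split.
  by move=> t; have [] := derive1_fst (df t).
suff -> : (fun u => (f u).1)^`() = (fun u => (derive1 f u).1) by exact: IH.
by apply/funext => t; have [] := derive1_fst (df t).
Qed.

Lemma differentiable_upto_snd (R : realType) (V W : normedModType R) n
    (f : R -> V * W) :
  differentiable_upto n f -> differentiable_upto n (fun u => (f u).2).
Proof.
elim: n f => //= n IH f [df df']; split.
  by move=> t; have [] := derive1_snd (df t).
suff -> : (fun u => (f u).2)^`() = (fun u => (derive1 f u).2) by exact: IH.
by apply/funext => t; have [] := derive1_snd (df t).
Qed.

Lemma derive1_is_derive (R : realType) (V : normedModType R) (f : R -> V) (t : R) (l : V) :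
  is_derive t 1 f l -> derivable f t 1 /\ derive1 f t = l.
Proof. by move=> fl; split; [exact: ex_derive|rewrite derive1E derive_val]. Qed.

Lemma is_derive_derive1 (R : realType) (V : normedModType R) (f : R -> V) (t : R) :
  derivable f t 1 -> is_derive t 1 f (derive1 f t).
Proof. by move=> df; rewrite derive1E; exact: derivableP. Qed.

Lemma differentiable_upto_cst (R : realType) (V : normedModType R) n (c : V) :
  differentiable_upto n (fun _ : R => c).
Proof.
elim: n c => //= n IH c; split; first by move=> t; exact: derivable_cst.
suff -> : (fun _ : R => c)^`() = (fun=> 0) by exact: IH.
by apply/funext => t; rewrite (derive1_cst c).
Qed.

Lemma differentiable_uptoD (R : realType) (V : normedModType R) n (f g : R -> V) :
  differentiable_upto n f -> differentiable_upto n g ->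
  differentiable_upto n (fun u => f u + g u).
Proof.
elim: n f g => //= n IH f g [df df'] [dg dg'].
have D (t : R) : is_derive t 1 (fun u => f u + g u) (derive1 f t + derive1 g t).
  by apply: is_deriveD; exact: is_derive_derive1.
split; first by move=> t; have [] := derive1_is_derive (D t).
suff -> : (fun u => f u + g u)^`() = (fun u => derive1 f u + derive1 g u) by exact: IH.
by apply/funext => t; have [] := derive1_is_derive (D t).
Qed.

Lemma differentiable_uptoM (R : realType) n (f g : R -> R) :
  differentiable_upto n f -> differentiable_upto n g ->
  differentiable_upto n (fun u => f u * g u).
Proof.
elim: n f g => //= n IH f g [df df'] [dg dg'].
have D (t : R) : is_derive t 1 (fun u => f u * g u) (f t * derive1 g t + g t * derive1 f t).
  by apply: is_deriveM; exact: is_derive_derive1.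
split; first by move=> t; have [] := derive1_is_derive (D t).
have -> : (fun u => f u * g u)^`() = (fun u => f u * derive1 g u + g u * derive1 f u).
  by apply/funext => t; have [] := derive1_is_derive (D t).
by apply: differentiable_uptoD; apply: IH => //;
  exact: differentiable_uptoW (conj _ _).
Qed.

Lemma is_derive_cos_comp (R : realType) (f : R -> R) (t : R) : derivable f t 1 ->
  is_derive t 1 (fun u => cos (f u)) (- sin (f t) * derive1 f t).
Proof.
move=> df; apply: (@is_derive1_comp _ cos f); exact: is_derive_derive1.
Qed.

Lemma is_derive_sin_comp (R : realType) (f : R -> R) (t : R) : derivable f t 1 ->
  is_derive t 1 (fun u => sin (f u)) (cos (f t) * derive1 f t).
Proof.
move=> df; apply: (@is_derive1_comp _ sin f); exact: is_derive_derive1.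
Qed.

Lemma differentiable_upto_cos_sin (R : realType) n (f : R -> R) :
  differentiable_upto n f ->
  differentiable_upto n (fun u => cos (f u)) /\
  differentiable_upto n (fun u => sin (f u)).
Proof.
elim: n f => //= n IH f [df df'].
have [Ic Is] := IH f (differentiable_uptoW (conj df df')).
have Dc (t : R) := derive1_is_derive (is_derive_cos_comp (df t)).
have Ds (t : R) := derive1_is_derive (is_derive_sin_comp (df t)).
split; split.
- by move=> t; have [] := Dc t.
- have -> : (fun u => cos (f u))^`() = (fun u => (-1 * sin (f u)) * derive1 f u).
    by apply/funext => t; have [_ ->] := Dc t; rewrite mulN1r.
  apply: differentiable_uptoM => //; apply: differentiable_uptoM => //.
  exact: differentiable_upto_cst.
- by move=> t; have [] := Ds t.
- have -> : (fun u => sin (f u))^`() = (fun u => cos (f u) * derive1 f u).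
    by apply/funext => t; have [_ ->] := Ds t.
  exact: differentiable_uptoM.
Qed.

Lemma smooth_pair (R : realType) (V W : normedModType R) (f : R -> V) (g : R -> W) :
  smooth f -> smooth g -> smooth (fun u => (f u, g u)).
Proof.
move=> /smoothP sf /smoothP sg; apply/smoothP => n.
exact: differentiable_upto_pair.
Qed.

Lemma smooth_fst (R : realType) (V W : normedModType R) (f : R -> V * W) :
  smooth f -> smooth (fun u => (f u).1).
Proof. by move=> /smoothP sf; apply/smoothP => n; exact: differentiable_upto_fst. Qed.

Lemma smooth_snd (R : realType) (V W : normedModType R) (f : R -> V * W) :
  smooth f -> smooth (fun u => (f u).2).
Proof. by move=> /smoothP sf; apply/smoothP => n; exact: differentiable_upto_snd. Qed.

Lemma smooth_cst (R : realType) (V : normedModType R) (c : V) :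
  smooth (fun _ : R => c).
Proof. by apply/smoothP => n; exact: differentiable_upto_cst. Qed.

Lemma smooth_id (R : realType) : smooth (fun t : R => t).
Proof.
apply/smoothP => -[//|n] /=; split=> [t|]; first exact: derivable_id.
have -> : (fun t : R => t)^`() = cst 1 by apply/funext => t; exact: derive1_id.
exact: differentiable_upto_cst.
Qed.

Lemma smoothD (R : realType) (V : normedModType R) (f g : R -> V) :
  smooth f -> smooth g -> smooth (fun u => f u + g u).
Proof.
move=> /smoothP sf /smoothP sg; apply/smoothP => n.
exact: differentiable_uptoD.
Qed.

Lemma smoothM (R : realType) (f g : R -> R) :
  smooth f -> smooth g -> smooth (fun u => f u * g u).
Proof.
move=> /smoothP sf /smoothP sg; apply/smoothP => n.
exact: differentiable_uptoM.
Qed.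

Lemma smooth_cos (R : realType) (f : R -> R) :
  smooth f -> smooth (fun u => cos (f u)).
Proof.
by move=> /smoothP sf; apply/smoothP => n; case: (differentiable_upto_cos_sin (sf n)).
Qed.

Lemma smooth_sin (R : realType) (f : R -> R) :
  smooth f -> smooth (fun u => sin (f u)).
Proof.
by move=> /smoothP sf; apply/smoothP => n; case: (differentiable_upto_cos_sin (sf n)).
Qed.

Lemma smooth_derivable (R : realType) (V : normedModType R) (f : R -> V) (t : R) :
  smooth f -> derivable f t 1.
Proof. by move=> sf; exact: (sf 0%N t). Qed.

Lemma smooth_continuous (R : realType) (V : normedModType R) (f : R -> V) :
  smooth f -> continuous f.
Proof.
move=> sf t; apply: differentiable_continuous; apply/derivable1_diffP.
exact: smooth_derivable.
Qed.

(** * The inclusion of the annulus in the torus *)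

(** The subtraction formula gives [cos (pi * (s - t)) = 1]. Since cosine is injective on [0, pi],
    the difference is 0 or, after subtracting a full turn, 2 in absolute value, and the latter
    happens only between the two ends of [-1, 1]. *)
Lemma cos_sin_eq (R : realType) (s t : R) : -1 <= s <= 1 -> -1 <= t <= 1 ->
  cos (pi * s) = cos (pi * t) -> sin (pi * s) = sin (pi * t) ->
  s = t \/ (`|s| = 1 /\ `|t| = 1).
Proof.
move=> s1 t1 cst sst; have pN : pi != 0 :> R by rewrite gt_eqF// pi_gt0.
have d1 : cos (pi * (s - t)) = 1.
  by rewrite mulrBr cosB cst sst -!expr2 cos2Dsin2.
have small (d : R) : 0 <= d <= 1 -> cos (pi * d) = 1 -> d = 0.
  move=> d01 cd; suff : pi * d = 0.
    by move/eqP; rewrite mulf_eq0 (negbTE pN) => /eqP.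
  have [d0 d1'] := andP d01.
  have p00 := pi_ge0 R; apply: (@cos_inj R); last by rewrite cos0 cd.
    have d2 : pi * d <= pi by nra.
    by rewrite in_itv /= mulr_ge0.
  by rewrite in_itv /= lexx p00.
have large (d : R) : 1 <= d <= 2 -> cos (pi * d) = 1 -> d = 2.
  move=> d12 cd; suff : 2 - d = 0 by lra.
  apply: small; first lra.
  have -> : pi * (2 - d) = - (pi * d) + pi *+ 2 by rewrite -mulr_natr; ring.
  by rewrite cosD2pi cosN.
have [st|ts] := leP t s.
  have [|] := leP (s - t) 1 => d.
    by left; have := small (s - t) _ d1; lra.
  right; have := large (s - t) _ d1 => E.
  have st2 : s - t = 2 by apply: E; lra.
  have -> : s = 1 by lra.
  have -> : t = -1 by lra.
  by rewrite normrN normr1.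
have d1' : cos (pi * (t - s)) = 1.
  by rewrite -cosN -mulrN opprB.
have [|] := leP (t - s) 1 => d.
  by left; have := small (t - s) _ d1'; lra.
right; have := large (t - s) _ d1' => E.
have ts2 : t - s = 2 by apply: E; lra.
have -> : t = 1 by lra.
have -> : s = -1 by lra.
by rewrite normrN normr1.
Qed.

Lemma unit_circle_param (R : realType) (x y : R) : x ^+ 2 + y ^+ 2 = 1 ->
  exists s, [/\ -1 <= s <= 1, x = cos (pi * s) & y = sin (pi * s)].
Proof.
move=> xy; have p0 := pi_gt0 R; have pN : pi != 0 :> R by rewrite gt_eqF.
have y2 := sqr_ge0 y.
have x1 : -1 <= x <= 1.
  by rewrite -ler_norml -(@expr_le1 _ 2)// -normrX ger0_norm ?sqr_ge0//; lra.
have a0 := acos_ge0 x1; have ap := acos_lepi x1.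
have q0 : 0 <= acos x / pi by rewrite divr_ge0// pi_ge0.
have q1 : acos x / pi <= 1 by rewrite ler_pdivrMr// mul1r.
have qE : pi * (acos x / pi) = acos x by rewrite mulrC divfK.
have sE : sin (acos x) = `|y|.
  have y2E : 1 - x ^+ 2 = y ^+ 2 by lra.
  by rewrite sin_acos// y2E sqrtr_sqr.
have cE : cos (acos x) = x by rewrite acosK// in_itv.
have [y0|y0] := leP 0 y.
  exists (acos x / pi); split; [lra|by rewrite qE cE|].
  by rewrite qE sE ger0_norm.
exists (- (acos x / pi)); split; [lra|by rewrite mulrN cosN qE cE|].
by rewrite mulrN sinN qE sE ltr0_norm// opprK.
Qed.

Lemma continuousM_fun (R : realType) (T : topologicalType) (f g : T -> R) :
  continuous f -> continuous g -> continuous (fun x => f x * g x).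
Proof. by move=> cf cg x; apply: cvgM; [exact: cf|exact: cg]. Qed.

Lemma continuousD_fun (R : realType) (T : topologicalType) (f g : T -> R) :
  continuous f -> continuous g -> continuous (fun x => f x + g x).
Proof. by move=> cf cg x; apply: cvgD; [exact: cf|exact: cg]. Qed.

Lemma continuousB_fun (R : realType) (T : topologicalType) (f g : T -> R) :
  continuous f -> continuous g -> continuous (fun x => f x - g x).
Proof. by move=> cf cg x; apply: cvgB; [exact: cf|exact: cg]. Qed.

Lemma continuous_id (T : topologicalType) : continuous (fun x : T => x).
Proof. by move=> x; exact: cvg_id. Qed.

Lemma continuous_cst (T U : topologicalType) (c : U) : continuous (fun _ : T => c).
Proof. by move=> x; exact: cvg_cst. Qed.

Lemma continuous_fst (T U : topologicalType) : continuous (fun x : T * U => x.1).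
Proof. exact: (continuous_fst_comp (@continuous_id _)). Qed.

Lemma continuous_snd (T U : topologicalType) : continuous (fun x : T * U => x.2).
Proof. exact: (continuous_snd_comp (@continuous_id _)). Qed.

Lemma inclusion_continuous (R : realType) : continuous (@inclusion R).
Proof.
have c : continuous (fun x : R * R * R => pi * x.2).
  by apply: continuousM_fun; [exact: continuous_cst|exact: continuous_snd].
apply: continuous_pair; first exact: continuous_fst.
apply: continuous_pair; first exact: (continuous_after (@continuous_cos R)).
exact: (continuous_after (@continuous_sin R)).
Qed.

Lemma thick_inclusion_continuous (R : realType) : continuous (@thick_inclusion R).
Proof.
apply: continuous_pair; last exact: continuous_snd.
apply: (continuous_after (@inclusion_continuous R)); exact: continuous_fst.
Qed.

Lemma annulus_inner_body (R : realType) (x : R * R * R) :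
  inner (annulus R) x -> body (annulus R) x.
Proof. by move=> [/= ? ?]; split=> //; lra. Qed.

Lemma annulus_boundary (R : realType) (x : R * R * R) :
  body (annulus R) x -> ~ inner (annulus R) x <-> `|x.2| = 1.
Proof.
move=> [/= x1 x2]; split=> [nx|xN [_ x2']].
  have [x20|x20] := leP 0 x.2.
    rewrite ger0_norm//; apply/eqP; rewrite eq_le; apply/andP; split; first lra.
    by rewrite leNgt; apply/negP => x2l; apply: nx; split=> //=; lra.
  rewrite ltr0_norm//; apply/eqP; rewrite eq_le; apply/andP; split; first lra.
  by rewrite leNgt; apply/negP => x2l; apply: nx; split=> //=; lra.
have : `|x.2| < 1 by rewrite ltr_norml.
by rewrite xN ltxx.
Qed.

Lemma inclusion_body (R : realType) (x : R * R * R) :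
  body (annulus R) x -> body (torus R) (inclusion x).
Proof. by move=> [/= ? ?]; split=> //=; exact: cos2Dsin2. Qed.

Lemma inclusion_eq (R : realType) (x y : R * R * R) :
  body (annulus R) x -> body (annulus R) y -> inclusion x = inclusion y ->
  x = y \/ (~ inner (annulus R) x /\ ~ inner (annulus R) y).
Proof.
case: x y => [x s] [y t] bx by_ [] xy cst sst; rewrite {x}xy in bx *.
have /= [->|[sN tN]] := cos_sin_eq bx.2 by_.2 cst sst; first by left.
by right; split; [exact: (annulus_boundary bx).2|exact: (annulus_boundary by_).2].
Qed.

Lemma inclusion_inj (R : realType) (x y : R * R * R) :
  inner (annulus R) x -> inner (annulus R) y -> inclusion x = inclusion y -> x = y.
Proof.
move=> ix iy; have bx := annulus_inner_body ix; have by_ := annulus_inner_body iy.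
by case/(inclusion_eq bx by_) => // -[].
Qed.

Lemma inclusion_surj (R : realType) :
  @inclusion R @` body (annulus R) = body (torus R).
Proof.
apply/seteqP; split=> [_ [x bx <-]|[z [a b]] [/= zz ab]].
  exact: inclusion_body.
by have [s [s1 aE bE]] := unit_circle_param ab; exists (z, s); rewrite // aE bE.
Qed.

Lemma compact_annulus (R : realType) : compact (body (annulus R)).
Proof.
pose P (p : R * R) := ((cos (pi * p.1), sin (pi * p.1)), p.2).
have -> : body (annulus R) = P @` (`[-1, 1] `*` `[-1, 1]).
  apply/seteqP; split=> [[[a b] s] [/= ab s1]|_ [[u s] [/= u1 s1] <-]].
    have [u [u1 aE bE]] := unit_circle_param ab.
    by exists (u, s); rewrite /P /= ?aE ?bE//; split; rewrite /= in_itv.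
  by split=> /=; [exact: cos2Dsin2|rewrite in_itv in s1].
apply: continuous_compact; last by apply: compact_setX; exact: segment_compact.
apply: continuous_subspaceT.
have c : continuous (fun x : R * R => pi * x.1).
  by apply: continuousM_fun; [exact: continuous_cst|exact: continuous_fst].
apply: continuous_pair; last exact: continuous_snd.
apply: continuous_pair; first exact: (continuous_after (@continuous_cos R)).
exact: (continuous_after (@continuous_sin R)).
Qed.

(** The differential of [inclusion] at [x], applied to the tangent vector [v]. *)
Definition d_inclusion (R : realType) (x v : R * R * R) : (R * R) * (R * R) :=
  (v.1, (- sin (pi * x.2) * (pi * v.2), cos (pi * x.2) * (pi * v.2))).

Lemma d_inclusion_lin (R : realType) (x v w : R * R * R) (a b : R) :
  a *: d_inclusion x v + b *: d_inclusion x w = d_inclusion x (a *: v + b *: w).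
Proof.
by congr (_, (_, _)); rewrite /= /GRing.scale /=; ring.
Qed.

(** The vector [(- sin, cos)] has length one and [pi] is nonzero. This injectivity is what keeps
    immersions immersed and crossings transversal in the torus. *)
Lemma d_inclusion_inj (R : realType) (x v : R * R * R) : d_inclusion x v = 0 -> v = 0.
Proof.
case: v => v1 v2 [/= -> s0 c0]; congr (_, _).
have := cos2Dsin2 (pi * x.2).
have p0 : (pi : R) != 0 by rewrite gt_eqF// pi_gt0.
move: s0 c0; move: (sin _) (cos _) => S C s0 c0 CS.
have : pi * v2 = 0.
  rewrite -[LHS]mul1r -CS.
  transitivity (C * (C * (pi * v2)) - S * (- S * (pi * v2))); first ring.
  by rewrite c0 s0; ring.
by move/eqP; rewrite mulf_eq0 (negbTE p0) /= => /eqP.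
Qed.

Lemma derive1_inclusion (R : realType) (c : R -> R * R * R) (t : R) :
  derivable c t 1 ->
  derivable (fun u => inclusion (c u)) t 1 /\
  derive1 (fun u => inclusion (c u)) t = d_inclusion (c t) (derive1 c t).
Proof.
move=> dc; have [d1 e1] := derive1_fst dc; have [d2 e2] := derive1_snd dc.
have Dpi : is_derive t 1 (fun u => pi * (c u).2) (pi * (derive1 c t).2).
  by rewrite -e2; apply: is_deriveZ; exact: is_derive_derive1.
have [dp ep] := derive1_is_derive Dpi.
have [dcos ecos] := derive1_is_derive (is_derive_cos_comp dp).
have [dsin esin] := derive1_is_derive (is_derive_sin_comp dp).
have [d3 e3] := derive1_pair dcos dsin.
have [d4 e4] := derive1_pair d1 d3.
by split; [exact: d4|rewrite [LHS]e4 e3 e1 ecos esin ep].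
Qed.

Lemma smooth_inclusion (R : realType) (c : R -> R * R * R) :
  smooth c -> smooth (fun u => inclusion (c u)).
Proof.
move=> sc; have s : smooth (fun u => pi * (c u).2).
  by apply: smoothM; [exact: smooth_cst|exact: smooth_snd].
apply: smooth_pair; first exact: smooth_fst.
by apply: smooth_pair; [exact: smooth_cos|exact: smooth_sin].
Qed.

Lemma smooth_thick_inclusion (R : realType) (c : R -> (R * R * R) * R) :
  smooth c -> smooth (fun u => thick_inclusion (c u)).
Proof.
move=> sc; apply: smooth_pair; last exact: smooth_snd.
by apply: smooth_inclusion; exact: smooth_fst.
Qed.

Lemma derive1_thick_inclusion (R : realType) (c : R -> (R * R * R) * R) (t : R) :
  derivable c t 1 ->
  derive1 (fun u => thick_inclusion (c u)) t =
  (d_inclusion (c t).1 (derive1 c t).1, (derive1 c t).2).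
Proof.
move=> dc; have [d1 e1] := derive1_fst dc; have [d2 e2] := derive1_snd dc.
have [d3 e3] := derive1_inclusion d1.
by have [_ e] := derive1_pair d3 d2; rewrite [LHS]e e3 e1 e2.
Qed.

(** * Isotopies of the annulus descend to the torus *)

(** [isotopy] with its inverse family made explicit, in a form symmetric in [h] and [g], so that
    every statement about [h] also serves for the inverse. *)
Definition isotopy_pair (R : realType) (W : normedModType R) (X Y : set W)
    (h g : R -> W -> W) : Prop :=
  [/\ forall x, X x -> h 0 x = x,
      {within [set p : R * W | 0 <= p.1 <= 1 /\ X p.2],
         continuous (fun p : R * W => h p.1 p.2)},
      {within [set p : R * W | 0 <= p.1 <= 1 /\ X p.2],
         continuous (fun p : R * W => g p.1 p.2)},
      forall t x, 0 <= t <= 1 -> X x ->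
        [/\ X (h t x), g t (h t x) = x, X (g t x) & h t (g t x) = x]
    & forall t x, 0 <= t <= 1 -> Y x -> Y (h t x) /\ Y (g t x)].

Lemma isotopyP (R : realType) (W : normedModType R) (X Y : set W)
    (h : R -> W -> W) :
  isotopy X Y h <-> exists g, isotopy_pair X Y h g.
Proof.
split=> [[h0 [g [ch cg hg]]]|[g [h0 ch cg hX hY]]].
  exists g; split=> // t x t01 Xx; have [hgx ghx hY gY] := hg t t01.
    by have [? ?] := hgx _ Xx; have [? ?] := ghx _ Xx.
  by split; [exact: hY|exact: gY].
split=> //; exists g; split=> // t t01; split=> x Xx.
- by have [] := hX t x t01 Xx.
- by have [] := hX t x t01 Xx.
- by have [] := hY t x t01 Xx.
- by have [] := hY t x t01 Xx.
Qed.

Lemma isotopy_pair_sym (R : realType) (W : normedModType R) (X Y : set W)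
    (h g : R -> W -> W) :
  isotopy_pair X Y h g -> isotopy_pair X Y g h.
Proof.
move=> [h0 ch cg hX hY]; have z01 : 0 <= (0 : R) <= 1 by rewrite lexx ler01.
split=> // [x Xx|t x t01 Xx|t x t01 Yx].
- by have [_ + _ _] := hX 0 x z01 Xx; rewrite h0.
- by have [? ? ? ?] := hX t x t01 Xx.
- by have [? ?] := hY t x t01 Yx.
Qed.

(* The isotopy is transported to the quotient: only boundary points are
   identified, and these do not move. *)
Lemma isotopy_descend (R : realType) (W W' : normedModType R) (X Y : set W)
    (q : W -> W') (k : R -> W -> W) :
  compact X -> continuous q ->
  (forall x x', X x -> X x' -> q x = q x' -> x = x' \/ (~ Y x /\ ~ Y x')) ->
  isotopy X Y k ->
  (forall t x, 0 <= t <= 1 -> X x -> ~ Y x -> k t x = x) ->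
  exists K, isotopy (q @` X) (q @` X) K /\
    forall t x, 0 <= t <= 1 -> X x -> K t (q x) = q (k t x).
Proof.
move=> cX cq qX /isotopyP[g [k0 ck cg kX kY]] kfix.
have z01 : 0 <= (0 : R) <= 1 by rewrite lexx ler01.
have gfix t x : 0 <= t <= 1 -> X x -> ~ Y x -> g t x = x.
  move=> t01 Xx nYx; have [_ + _ _] := kX t x t01 Xx.
  by rewrite kfix.
(* [sec] is a section of [q] over the image of [X]; elsewhere it takes the default value 0. *)
have /choice[sec secP] : forall w, exists x, (q @` X) w -> X x /\ q x = w.
  by move=> w; have [[x Xx xw]|nw] := pselect ((q @` X) w); [exists x|exists 0].
pose down (f : R -> W -> W) t w := q (f t (sec w)).
have downE f t x : 0 <= t <= 1 ->
    (forall x, X x -> ~ Y x -> f t x = x) -> X x -> down f t (q x) = q (f t x).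
  move=> t01 ffix Xx; have [|Xs sE] := secP (q x); first by exists x.
  rewrite /down; have [-> //|[nY nY']] := qX _ _ Xs Xx sE.
  by rewrite !ffix.
have kE t x : 0 <= t <= 1 -> X x -> down k t (q x) = q (k t x).
  by move=> t01 Xx; apply: downE => // y; exact: kfix.
have gE t x : 0 <= t <= 1 -> X x -> down g t (q x) = q (g t x).
  by move=> t01 Xx; apply: downE => // y; exact: gfix.
have ctsdown (f : R -> W -> W) :
    {within [set p : R * W | 0 <= p.1 <= 1 /\ X p.2],
       continuous (fun p : R * W => f p.1 p.2)} ->
    (forall t x, 0 <= t <= 1 -> X x -> down f t (q x) = q (f t x)) ->
    {within [set p : R * W' | 0 <= p.1 <= 1 /\ (q @` X) p.2],
       continuous (fun p : R * W' => down f p.1 p.2)}.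
  move=> cf fE; pose Q (p : R * W) := (p.1, q p.2).
  have -> : [set p : R * W' | 0 <= p.1 <= 1 /\ (q @` X) p.2] =
      Q @` [set p : R * W | 0 <= p.1 <= 1 /\ X p.2].
    apply/seteqP; split=> [[t w] /= [t01 [x Xx <-]]|_ [[t x] /= [t01 Xx] <-]].
      by exists (t, x).
    by split=> //=; exists x.
  (* Continuity is tested upstairs, on the compact product of [0, 1] and [X]. *)
  apply: within_quotient.
  - exact: norm_hausdorff.
  - have -> : [set p : R * W | 0 <= p.1 <= 1 /\ X p.2] = `[0, 1] `*` X.
      by apply/seteqP; split=> -[t x] /=; rewrite in_itv.
    by apply: compact_setX => //; exact: segment_compact.
  - apply: continuous_subspaceT; apply: continuous_pair.
      exact: continuous_fst.
    by apply: (continuous_after cq); exact: continuous_snd.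
  - apply: (@within_eq _ _ _ (fun p => q (f p.1 p.2))).
      by move=> [t x] [/= t01 Xx]; rewrite fE.
    apply: (@within_comp _ _ _ _ setT) cf _ => //.
    exact: continuous_subspaceT.
exists (down k); split=> //; apply/isotopyP; exists (down g); split.
- by move=> _ [x Xx <-]; rewrite kE// k0.
- exact: ctsdown.
- exact: ctsdown.
- move=> t _ t01 [x Xx <-]; have [Xk gk Xg kg] := kX t x t01 Xx.
  by rewrite kE// gE// gE// kE// gk kg; split=> //; exact: imageP.
- move=> t _ t01 [x Xx <-]; have [Xk gk Xg kg] := kX t x t01 Xx.
  by rewrite kE// gE//; split; exact: imageP.
Qed.

(** * Damping an isotopy on a collar of the boundary *)

Definition clamp (R : realType) (r s : R) : R := Num.max (- r) (Num.min r s).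

Lemma clampP (R : realType) (r s : R) : 0 <= r ->
  [\/ -r <= s <= r /\ clamp r s = s, r < s /\ clamp r s = r
    | s < - r /\ clamp r s = - r].
Proof.
move=> r0; rewrite /clamp; have [rs|sr] := ltP r s.
  apply: Or32; split=> //; rewrite max_r//; lra.
have [sr'|rs'] := ltP s (- r); first exact: Or33.
by apply: Or31; split=> //; lra.
Qed.

Lemma clamp_continuous (R : realType) (r : R) : continuous (clamp r).
Proof.
move=> s; apply: (@continuous_max _ _ (fun=> - r) (fun s => Num.min r s)).
  exact: cvg_cst.
apply: (@continuous_min _ _ (fun=> r) id); first exact: cvg_cst.
exact: cvg_id.
Qed.

(** The piecewise linear map that is the identity on [-r, r] and has slope [a] beyond. *)
Definition stretch (R : realType) (r a s : R) : R :=
  clamp r s + a * (s - clamp r s).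

Lemma stretch_continuous (R : realType) (r a : R) : continuous (stretch r a).
Proof.
apply: continuousD_fun; first exact: clamp_continuous.
apply: continuousM_fun; first exact: continuous_cst.
apply: continuousB_fun; [exact: continuous_id|exact: clamp_continuous].
Qed.

(** Stretching with positive slope does not change [clamp r s]; it only multiplies the excess over
    it, so slopes multiply under composition. *)
Lemma stretchK (R : realType) (r a b s : R) :
  0 <= r -> 0 < a -> b * a = 1 -> stretch r b (stretch r a s) = s.
Proof.
move=> r0 a0 ba.
have cE : clamp r (stretch r a s) = clamp r s.
  rewrite /stretch; have [[s1 ->]|[s1 ->]|[s1 ->]] := clampP s r0.
  - by rewrite subrr mulr0 addr0; have [[? ->]|[? ?]|[? ?]] := clampP s r0 => //; lra.
  - have p : 0 < a * (s - r) by apply: mulr_gt0 => //; lra.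
    by have [[? ?]|[? ->]|[? ?]] := clampP (r + a * (s - r)) r0 => //; lra.
  - have p : 0 < a * (- r - s) by apply: mulr_gt0 => //; lra.
    by have [[? ?]|[? ?]|[? ->]] := clampP (- r + a * (s - - r)) r0 => //; lra.
rewrite {1}/stretch cE /stretch.
transitivity (clamp r s + (b * a) * (s - clamp r s)); first ring.
by rewrite ba; ring.
Qed.

Lemma stretch_id (R : realType) (r a s : R) :
  0 <= r -> `|s| <= r -> stretch r a s = s.
Proof.
move=> r0; rewrite ler_norml => sr; rewrite /stretch.
have [[_ ->]|[? ?]|[? ?]] := clampP s r0; [|lra|lra].
by rewrite subrr mulr0 addr0.
Qed.

(** The equation between [u] and [v] says that the end [u] goes to [v]. It is used to pass from
    [-1, 1] to [-2, 2] and back. *)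
Lemma stretch_lt (R : realType) (r a s u v : R) :
  0 <= r < u -> 0 < a -> r + a * (u - r) = v ->
  (`|s| < u -> `|stretch r a s| < v) /\
  (`|s| <= u -> `|stretch r a s| <= v) /\
  stretch r a u = v /\ stretch r a (- u) = - v.
Proof.
move=> ru a0 uv; have r0 : 0 <= r by lra.
have av : 0 < a * (u - r) by apply: mulr_gt0 => //; lra.
rewrite !ltr_norml !ler_norml; split; [|split; [|split]].
- move=> su; rewrite /stretch.
  have [[? ->]|[? ->]|[? ->]] := clampP s r0.
  + by rewrite subrr mulr0 addr0; lra.
  + have p : 0 < a * (s - r) by apply: mulr_gt0 => //; lra.
    have p' : 0 < a * (u - s) by apply: mulr_gt0 => //; lra.
    lra.
  + have p : 0 < a * (- r - s) by apply: mulr_gt0 => //; lra.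
    have p' : 0 < a * (u + s) by apply: mulr_gt0 => //; lra.
    lra.
- move=> su; rewrite /stretch.
  have [[? ->]|[? ->]|[? ->]] := clampP s r0.
  + by rewrite subrr mulr0 addr0; lra.
  + have p : 0 < a * (s - r) by apply: mulr_gt0 => //; lra.
    have p' : 0 <= a * (u - s) by apply: mulr_ge0; lra.
    lra.
  + have p : 0 < a * (- r - s) by apply: mulr_gt0 => //; lra.
    have p' : 0 <= a * (u + s) by apply: mulr_ge0; lra.
    lra.
- by rewrite /stretch; have [[? ?]|[? ->]|[? ?]] := clampP u r0; lra.
- by rewrite /stretch; have [[? ?]|[? ?]|[? ->]] := clampP (- u) r0; lra.
Qed.

(** [sg] reads the coordinate across the annulus and [upd] overwrites it, with the usual laws of a
    getter and a setter. [Y] is the part of [X] off the boundary circles, or off their products with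
    the interval in the thickened case. *)
Definition collared (R : realType) (W : normedModType R) (X Y : set W)
    (sg : W -> R) (upd : W * R -> W) : Prop :=
  [/\ continuous sg /\ continuous upd,
      [/\ forall x r, sg (upd (x, r)) = r,
          forall x r r', upd (upd (x, r), r') = upd (x, r')
        & forall x, upd (x, sg x) = x],
      forall x, X x -> `|sg x| <= 1,
      forall x r, X x -> `|r| <= 1 -> X (upd (x, r))
    & (forall x, X x -> Y x <-> `|sg x| < 1) /\ Y `<=` X].

Lemma norm1_cases (R : realType) (e : R) : `|e| = 1 -> e = 1 \/ e = -1.
Proof.
have [e0|e0] := leP 0 e; first by rewrite ger0_norm//; left.
by rewrite ltr0_norm// => <-; right; rewrite opprK.
Qed.

(** A boundary point cannot enter [Y], since the inverse isotopy preserves [Y]. Hence [sg] keeps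
    absolute value 1 along its path, never vanishes, and by the intermediate value theorem cannot
    change sign: the two boundary components are not exchanged. *)
Lemma isotopy_boundary (R : realType) (W : normedModType R) (X Y : set W)
    (sg : W -> R) (upd : W * R -> W) (h g : R -> W -> W) (t : R) (x : W) :
  collared X Y sg upd -> isotopy_pair X Y h g ->
  0 <= t <= 1 -> X x -> `|sg x| = 1 -> sg (h t x) = sg x.
Proof.
move=> [[csg _] _ X1 _ [XY _]] [h0 ch _ hX hY] t01 Xx sx1.
have f1 u : 0 <= u <= 1 -> `|sg (h u x)| = 1.
  move=> u01; have [Xh gh _ _] := hX u x u01 Xx.
  apply/eqP; rewrite eq_le X1//= leNgt; apply/negP => /(XY _ Xh).2 Yh.
  have [_] := hY u _ u01 Yh; rewrite gh => /(XY _ Xx).1.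
  by rewrite sx1 ltxx.
have cf : {within `[0, t], continuous (fun u => sg (h u x))}.
  apply: (@within_comp _ _ _ _ setT (fun u => h u x) sg) => //; last first.
    exact: continuous_subspaceT.
  apply: (@within_comp _ _ _ `[0, t] _ (fun u => (u, x)) _ _ _ ch).
    by move=> u /=; rewrite in_itv /= => u0t; split=> //; lra.
  apply: continuous_subspaceT; apply: continuous_pair.
    exact: continuous_id.
  exact: continuous_cst.
have t0 : 0 <= t by lra.
have no0 : Num.min (sg (h 0 x)) (sg (h t x)) <= 0 <= Num.max (sg (h 0 x)) (sg (h t x)) -> False.
  move=> /(IVT t0 cf)[u]; rewrite in_itv /= => u0t hu0.
  have := f1 u; rewrite hu0 normr0 => h1; have : (0 : R) = 1 by apply: h1; lra.
  by move/eqP; rewrite eq_sym oner_eq0.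
move: no0; rewrite h0//.
have [-> | ->] := norm1_cases sx1; have [-> | ->] := norm1_cases (f1 t t01) => // n0.
  by exfalso; apply: n0; rewrite ge_min le_max; lra.
by exfalso; apply: n0; rewrite ge_min le_max; lra.
Qed.

(** [y] is the coordinate after stretching to [-2, 2] and [rho] its excess over [-1, 1]. The point
    is pushed back to [-1, 1], moved by [h] for a time that decreases to 0 as the excess grows to 1,
    then given its excess back and shrunk to the original width. *)
Definition collar_move (R : realType) (W : normedModType R) (sg : W -> R)
    (upd : W * R -> W) (r a b : R) (h : R -> W -> W) (t : R) (x : W) : W :=
  let y := stretch r a (sg x) in
  let rho := y - clamp 1 y in
  let x' := h (t * (1 - `|rho|)) (upd (x, clamp 1 y)) in
  upd (x', stretch r b (sg x' + rho)).

(** Either [rho] is zero, or the pushed-back point lies on the boundary, where [h] preserves [sg].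
    In both cases clamping [sg x' + rho] returns [sg x'], so the excess can be read off the image;
    this is what makes the move invertible. *)
Lemma collar_moveP (R : realType) (W : normedModType R) (X Y : set W)
    (sg : W -> R) (upd : W * R -> W) (r a b : R) (h g : R -> W -> W)
    (t : R) (x : W) :
  collared X Y sg upd -> isotopy_pair X Y h g ->
  0 <= r < 1 -> 0 < a -> 0 < b -> r + a * (1 - r) = 2 ->
  0 <= t <= 1 -> X x ->
  let y := stretch r a (sg x) in
  let rho := y - clamp 1 y in
  let x' := h (t * (1 - `|rho|)) (upd (x, clamp 1 y)) in
  [/\ [/\ X (upd (x, clamp 1 y)), 0 <= t * (1 - `|rho|) <= 1 & X x'],
      clamp 1 (sg x' + rho) = sg x',
      `|sg x' + rho| <= 2
    & `|sg x| < 1 -> `|sg x' + rho| < 2].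
Proof.
move=> col iso r01 a0 b0 ra t01 Xx y rho x'.
have [_ [su uu us] X1 Xu _] := col.
have [_ _ _ hX _] := iso.
have [st_lt [st_le _]] := stretch_lt (sg x) r01 a0 ra.
have y2 : `|y| <= 2 by apply: st_le; exact: X1.
have one0 : 0 <= (1 : R) by [].
have [c1 rho1] : `|clamp 1 y| <= 1 /\ `|rho| <= 1.
  rewrite /rho; move: y2; rewrite !ler_norml => y2.
  by have [[? ->]|[? ->]|[? ->]] := clampP y one0; split; lra.
have Xc : X (upd (x, clamp 1 y)) by exact: Xu.
have rho0 := normr_ge0 rho.
have tt : 0 <= t * (1 - `|rho|) <= 1.
  by rewrite mulr_ge0; [|lra|lra]; rewrite /= mulr_ile1; lra.
have [Xx' _ _ _] := hX _ _ tt Xc.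
split=> //.
- have := X1 _ Xx'; rewrite ler_norml => sx'.
  rewrite /rho; have [[y1 cE]|[y1 cE]|[y1 cE]] := clampP y one0; rewrite cE.
  + rewrite subrr addr0.
    by have [[? ->]|[? ?]|[? ?]] := clampP (sg x') one0 => //; lra.
  + have -> : sg x' = 1.
      by rewrite /x' (isotopy_boundary col iso)// su cE// normr1.
    by have [[? ?]|[? ->]|[? ?]] := clampP (1 + (y - 1)) one0 => //; lra.
  + have -> : sg x' = -1.
      by rewrite /x' (isotopy_boundary col iso)// su cE// normrN normr1.
    by have [[? ?]|[? ?]|[? ->]] := clampP (-1 + (y - -1)) one0 => //; lra.
- have := X1 _ Xx'; rewrite ler_norml => sx'.
  move: y2; rewrite !ler_norml => y2.
  rewrite /rho; have [[y1 cE]|[y1 cE]|[y1 cE]] := clampP y one0; rewrite cE; [lra| |].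
  + have -> : sg x' = 1.
      by rewrite /x' (isotopy_boundary col iso)// su cE// normr1.
    lra.
  + have -> : sg x' = -1.
      by rewrite /x' (isotopy_boundary col iso)// su cE// normrN normr1.
    lra.
- move=> /st_lt; have := X1 _ Xx'; rewrite ler_norml => sx'.
  rewrite !ltr_norml -/y => y2'.
  rewrite /rho; have [[y1 cE]|[y1 cE]|[y1 cE]] := clampP y one0; rewrite cE; [lra| |].
  + have -> : sg x' = 1.
      by rewrite /x' (isotopy_boundary col iso)// su cE// normr1.
    lra.
  + have -> : sg x' = -1.
      by rewrite /x' (isotopy_boundary col iso)// su cE// normrN normr1.
    lra.
Qed.

(** The excess [rho] survives the move, and the running time depends only on [t] and [rho]. The same
    construction with the inverse isotopy therefore undoes it at the same running time. *)
Lemma collar_moveK (R : realType) (W : normedModType R) (X Y : set W)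
    (sg : W -> R) (upd : W * R -> W) (r a b : R) (h g : R -> W -> W)
    (t : R) (x : W) :
  collared X Y sg upd -> isotopy_pair X Y h g ->
  0 <= r < 1 -> 0 < a -> 0 < b -> r + a * (1 - r) = 2 -> a * b = 1 ->
  r + b * (2 - r) = 1 ->
  0 <= t <= 1 -> X x ->
  [/\ X (collar_move sg upd r a b h t x),
      collar_move sg upd r a b g t (collar_move sg upd r a b h t x) = x
    & Y x -> Y (collar_move sg upd r a b h t x)].
Proof.
move=> col iso r01 a0 b0 ra ab rb t01 Xx.
have [[Xc tt Xx'] cl le2 lt2] := collar_moveP col iso r01 a0 b0 ra t01 Xx.
have [_ [su uu us] X1 Xu [XY _]] := col.
have [_ _ _ hX _] := iso; have [_ gh _ _] := hX _ _ tt Xc.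
have r0 : 0 <= r by lra.
have r2 : 0 <= r < 2 by lra.
rewrite {1 3 4}/collar_move.
move: cl le2 lt2 gh Xx'.
set y := stretch r a (sg x); set rho := y - clamp 1 y.
set x' := h _ _ => cl le2 lt2 gh Xx'.
have [sb_lt [sb_le _]] := stretch_lt (sg x' + rho) r2 b0 rb.
have XX : X (upd (x', stretch r b (sg x' + rho))) by apply: Xu => //; exact: sb_le.
split=> //; last first.
  move=> /(XY _ Xx).1 s1; apply/(XY _ XX); rewrite su; apply: sb_lt; exact: lt2.
rewrite /collar_move -/y -/rho -/x' su stretchK// cl uu.
have -> : sg x' + rho - sg x' = rho by ring.
rewrite us gh uu su.
by rewrite /rho addrC subrK /y stretchK ?us// mulrC.
Qed.

Lemma collar_move_continuous (R : realType) (W : normedModType R) (X Y : set W)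
    (sg : W -> R) (upd : W * R -> W) (r a b : R) (h g : R -> W -> W) :
  collared X Y sg upd -> isotopy_pair X Y h g ->
  0 <= r < 1 -> 0 < a -> 0 < b -> r + a * (1 - r) = 2 ->
  {within [set p : R * W | 0 <= p.1 <= 1 /\ X p.2],
     continuous (fun p : R * W => collar_move sg upd r a b h p.1 p.2)}.
Proof.
move=> col iso r01 a0 b0 ra; have [[csg cupd] _ _ _ _] := col.
have [_ ch _ _ _] := iso.
pose y (p : R * W) := stretch r a (sg p.2).
pose rho p := y p - clamp 1 (y p).
have cy : continuous y.
  apply: (continuous_after (@stretch_continuous R r a)).
  by apply: (continuous_after csg); exact: continuous_snd.
have cc : continuous (fun p => clamp 1 (y p)).
  exact: (continuous_after (@clamp_continuous R 1)).
have cr : continuous rho by exact: continuousB_fun.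
have cn : continuous (fun p : R * W => p.1 * (1 - `|rho p|)).
  apply: continuousM_fun; first exact: continuous_fst.
  apply: continuousB_fun; first exact: continuous_cst.
  by apply: (continuous_after (@norm_continuous R R)).
pose D := [set p : R * W | 0 <= p.1 <= 1 /\ X p.2].
pose x' (p : R * W) := h (p.1 * (1 - `|rho p|)) (upd (p.2, clamp 1 (y p))).
have cx' : {within D, continuous x'}.
  apply: (@within_comp _ _ _ D _
    (fun p : R * W => (p.1 * (1 - `|rho p|), upd (p.2, clamp 1 (y p)))) _ _ _ ch).
    move=> [t x] [/= t01 Xx].
    by have [[Xc tt _] _ _ _] := collar_moveP col iso r01 a0 b0 ra t01 Xx.
  apply: continuous_subspaceT; apply: continuous_pair => //.
  apply: (continuous_after cupd); apply: continuous_pair => //.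
  exact: continuous_snd.
apply: (@within_comp _ _ _ D setT
  (fun p : R * W => (x' p, stretch r b (sg (x' p) + rho p))) upd) => //.
  apply: within_pair => //.
  apply: (@within_comp _ _ _ D setT (fun p : R * W => (x' p, p))
    (fun q : W * (R * W) => stretch r b (sg q.1 + rho q.2))) => //.
    apply: within_pair => //; apply: continuous_subspaceT; exact: continuous_id.
  apply: continuous_subspaceT.
  apply: (continuous_after (@stretch_continuous R r b)).
  apply: continuousD_fun.
    by apply: (continuous_after csg); exact: continuous_fst.
  by apply: (continuous_after cr); exact: continuous_snd.
exact: continuous_subspaceT.
Qed.

(** The coordinate attains its maximal absolute value on the compact product of [0, 1] and [C], and
    that maximum is below 1 because the isotopy keeps [C] inside [Y]. *)
Lemma isotopy_bound (R : realType) (W : normedModType R) (X Y C : set W)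
    (sg : W -> R) (upd : W * R -> W) (h g : R -> W -> W) :
  collared X Y sg upd -> isotopy_pair X Y h g -> compact C -> C `<=` Y ->
  exists2 r, 0 <= r < 1 &
    forall t x, 0 <= t <= 1 -> C x -> `|sg (h t x)| <= r.
Proof.
move=> col iso cC CY; have [[csg _] _ X1 _ [XY YX]] := col.
have [_ ch _ hX hY] := iso.
have [[x0 Cx0]|C0] := pselect (exists x, C x); last first.
  by exists 0; [lra|move=> t x _ Cx; case: C0; exists x].
pose D : set (R * W) := `[0, 1] `*` C.
have cD : compact D by apply: compact_setX => //; exact: segment_compact.
have DX : forall p, D p -> 0 <= p.1 <= 1 /\ X p.2.
  by move=> [t x] [/= + /CY/YX ?]; rewrite in_itv.
have cf : {within D, continuous (fun p : R * W => `|sg (h p.1 p.2)|)}.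
  apply: (@within_comp _ _ _ D setT (fun p : R * W => h p.1 p.2) (fun x => `|sg x|)) => //.
    exact: (continuous_subspaceW DX).
  apply: continuous_subspaceT.
  exact: (continuous_after (@norm_continuous R R) csg).
have D0 : D !=set0 by exists (0, x0); split=> //=; rewrite in_itv /= lexx ler01.
have [[t1 x1] /set_mem[/= + Cx1] mx] := compact_EVT_max D0 cD cf.
rewrite in_itv /= => t1_01; exists `|sg (h t1 x1)|.
  rewrite normr_ge0 /=; have Yx := CY _ Cx1; have [Yh _] := hY _ _ t1_01 Yx.
  by apply/(XY _ (YX _ Yh)).
move=> t x t01 Cx; apply: (mx (t, x)); rewrite inE; split => //=; rewrite in_itv.
Qed.

(* Outside the range of [sg] on [C] the annulus is stretched to [-2, 2], and on
   the added collar the motion is that of the boundary, damped to the identity. *)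
Lemma collar_isotopy (R : realType) (W : normedModType R) (X Y C : set W)
    (sg : W -> R) (upd : W * R -> W) (h : R -> W -> W) :
  collared X Y sg upd -> isotopy X Y h -> compact C -> C `<=` Y ->
  exists k, [/\ isotopy X Y k,
    forall t x, 0 <= t <= 1 -> X x -> ~ Y x -> k t x = x
    & forall t x, 0 <= t <= 1 -> C x -> k t x = h t x].
Proof.
move=> col /isotopyP[g iso] cC CY.
have [r r01 rC] := isotopy_bound col iso cC CY.
have iso' := isotopy_pair_sym iso.
have [_ [su uu us] X1 Xu [XY YX]] := col.
have [h0 _ _ hX _] := iso; have r0 : 0 <= r by lra.
have z01 : 0 <= (0 : R) <= 1 by rewrite lexx ler01.
(* The slopes that carry [r, 1] onto [r, 2] and back. *)
pose a := (2 - r) / (1 - r); pose b := (1 - r) / (2 - r).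
have n1 : 1 - r != 0 by rewrite gt_eqF//; lra.
have n2 : 2 - r != 0 by rewrite gt_eqF//; lra.
have a0 : 0 < a by apply: divr_gt0; lra.
have b0 : 0 < b by apply: divr_gt0; lra.
have ra : r + a * (1 - r) = 2 by rewrite /a divfK//; ring.
have rb : r + b * (2 - r) = 1 by rewrite /b divfK//; ring.
have ab : a * b = 1 by rewrite /a /b mulf_div [X in _ / X]mulrC divff// mulf_neq0.
(* On the boundary the stretched coordinate is 2 or -2, so the excess has absolute value 1 and [h]
   runs for time 0. *)
have stop t x : t = 0 \/ ~ Y x -> X x -> collar_move sg upd r a b h t x = x.
  move=> tY Xx; rewrite /collar_move.
  set y := stretch r a (sg x); set rho := y - clamp 1 y.
  have -> : t * (1 - `|rho|) = 0.
    case: tY => [->|nY]; first by rewrite mul0r.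
    have sx : `|sg x| = 1.
      apply/eqP; rewrite eq_le X1//= leNgt; apply/negP => s1.
      by apply: nY; apply/(XY _ Xx).
    suff -> : `|rho| = 1 by rewrite subrr mulr0.
    have [_ [_ [y1 yN1]]] := stretch_lt (sg x) r01 a0 ra.
    rewrite /rho /y; have [-> | ->] := norm1_cases sx; rewrite ?y1 ?yN1.
      have [[? _]|[_ ->]|[? _]] := clampP (2 : R) ler01; [lra| |lra].
      by have -> : 2 - 1 = 1 :> R by [ring]; rewrite normr1.
    have [[? _]|[? _]|[_ ->]] := clampP (- 2 : R) ler01; [lra|lra|].
    by have -> : -2 - -1 = -1 :> R by [ring]; rewrite normrN normr1.
  have Xc : X (upd (x, clamp 1 y)).
    apply: Xu => //; rewrite ler_norml.
    by have [[? ->]|[? ->]|[? ->]] := clampP y ler01 => //; lra.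
  rewrite h0// su uu /rho addrC subrK /y stretchK ?us// mulrC.
  exact: ab.
exists (collar_move sg upd r a b h); split.
- apply/isotopyP; exists (collar_move sg upd r a b g); split.
  + by move=> x Xx; apply: stop => //; left.
  + exact: (collar_move_continuous col iso).
  + exact: (collar_move_continuous col iso').
  + move=> t x t01 Xx.
    have [] := collar_moveK col iso r01 a0 b0 ra ab rb t01 Xx.
    by have [] := collar_moveK col iso' r01 a0 b0 ra ab rb t01 Xx.
  + move=> t x t01 Yx; have Xx := YX _ Yx.
    have [_ _ H1] := collar_moveK col iso r01 a0 b0 ra ab rb t01 Xx.
    have [_ _ H2] := collar_moveK col iso' r01 a0 b0 ra ab rb t01 Xx.
    by split; [exact: H1|exact: H2].
- by move=> t x t01 Xx nY; apply: stop => //; right.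
(* On [C] and on its whole track [sg] stays within [-r, r], where both stretchings are the identity
   and the excess is zero. *)
- move=> t x t01 Cx; have Xx := YX _ (CY _ Cx); rewrite /collar_move.
  have sr : `|sg x| <= r by have := rC 0 x z01 Cx; rewrite h0.
  have sr' := rC t x t01 Cx.
  rewrite stretch_id//.
  have -> : clamp 1 (sg x) = sg x.
    have := X1 _ Xx; rewrite ler_norml => s1.
    by have [[? ->]|[? ?]|[? ?]] := clampP (sg x) ler01 => //; lra.
  by rewrite subrr normr0 subr0 mulr1 us addr0 stretch_id// us.
Qed.

(** * The induced maps *)

Lemma class_of_eq (T : Type) (e : T -> T -> Prop) (x y : T) :
  clos_refl_sym_trans T e x y -> class_of e x = class_of e y.
Proof.
move=> exy; apply: eq_exist; apply/seteqP; split=> z /= ez.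
  by apply: rst_trans ez; exact: rst_sym.
exact: rst_trans ez.
Qed.

Lemma class_of_inj (T : Type) (e : T -> T -> Prop) (x y : T) :
  class_of e x = class_of e y -> clos_refl_sym_trans T e x y.
Proof.
move=> /(congr1 sval) /= E.
have : [set z | clos_refl_sym_trans T e y z] y by exact: rst_refl.
by rewrite -E.
Qed.

(** The value on a class is computed from a chosen representative. Any other representative is
    joined to it by a chain of moves, which [F] carries over step by step. *)
Lemma classes_map (T U : Type) (e : T -> T -> Prop) (e' : U -> U -> Prop)
    (F : T -> U) :
  (forall x y, e x y -> e' (F x) (F y)) ->
  exists mu : classes e -> classes e',
    forall x, mu (class_of e x) = class_of e' (F x).
Proof.
move=> eF; have repr (c : classes e) : {x | c = class_of e x}.
  by apply: cid; case: c => S [x xS]; exists x; subst S.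
exists (fun c => class_of e' (F (projT1 (repr c)))) => x.
case: (repr _) => y E /=; have xy := class_of_inj E; apply: class_of_eq; apply: rst_sym.
elim: xy {E} => [u v /eF|u|u v _|u v w _ uv _ vw].
- exact: rst_step.
- exact: rst_refl.
- exact: rst_sym.
- exact: rst_trans vw.
Qed.

(** One period of each circle suffices, so the curves form a finite union of continuous images of
    [0, 1]. *)
Lemma compact_curves (R : realType) (W : normedModType R) (C : curves W) :
  immersed C -> compact [set w | exists2 x : param R (ncirc C), pdom x & pt x = w].
Proof.
move=> [sC _ pC].
have -> : [set w | exists2 x : param R (ncirc C), pdom x & pt x = w] =
    \big[setU/set0]_(i <- index_enum (option 'I_(ncirc C))) (crv C i @` `[0, 1]).
  rewrite -bigcup_seq; apply/seteqP; split=> [w [[i t] /= dx <-]|w].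
    exists i; first by rewrite /= mem_index_enum.
    case: i dx => [i _|t01]; last by exists t; rewrite //= in_itv.
    have [t' t01 E] := periodic_unit (pC i) t.
    by exists t'; rewrite ?E //= in_itv.
  move=> [i _ [t /=]]; rewrite in_itv /= => t01 <-.
  by exists (i, t) => //; rewrite /pdom /=; case: (i).
apply: bigsetU_compact => i _; apply: continuous_compact; last exact: segment_compact.
by apply: continuous_subspaceT; exact: smooth_continuous.
Qed.

(** Injectivity of the inclusion on the open annulus prevents new double points; injectivity of its
    differential preserves immersion and transversality. *)
Lemma is_diagram_inclusion (R : realType) (D : prediagram (R * R * R)%type) :
  is_diagram (annulus R) D -> is_diagram (torus R) (map_diagram (@inclusion R) D).
Proof.
move=> [[sD nD pD] iD dD tD oD].
have dbl x y : double_point (D := map_diagram (@inclusion R) D) x y ->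
    double_point (D := D) x y.
  move=> [dx dy nxy E]; split=> //.
  by apply: inclusion_inj E; exact: iD.
have der i (t : R) : derive1 (crv (map_curves (@inclusion R) (dcrv D)) i) t =
    d_inclusion (crv (dcrv D) i t) (derive1 (crv (dcrv D) i) t).
  by have [] := derive1_inclusion (@smooth_derivable R _ _ t (sD i)).
split=> //.
- split=> [i|x dx|i t]; first exact: smooth_inclusion.
    rewrite der; apply/eqP => /d_inclusion_inj /eqP.
    exact/negP/nD.
  by rewrite /= pD.
- by move=> x dx; apply/inclusion_body/annulus_inner_body; exact: iD.
- move=> x y xy; have [nx oxy lin] := dD _ _ (dbl _ _ xy).
  split=> // a b; rewrite !der.
  have [_ _ _ E] := dbl _ _ xy; rewrite /dpt /pt in E; rewrite E d_inclusion_lin.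
  by move/d_inclusion_inj/lin.
- by move=> x y z /dbl xy /dbl xz; exact: tD xy xz.
Qed.

Lemma collared_annulus (R : realType) :
  collared (body (annulus R)) (inner (annulus R)) snd
    (fun p : (R * R * R) * R => (p.1.1, p.2)).
Proof.
split=> //.
- split; first exact: continuous_snd.
  apply: continuous_pair; last exact: continuous_snd.
  by apply: continuous_fst_comp; exact: continuous_fst.
- by split=> // -[].
- by move=> x [_ x1]; rewrite ler_norml.
- by move=> x r [x1 _]; rewrite ler_norml.
- split=> [x [x1 x2]|x]; last exact: annulus_inner_body.
  by rewrite ltr_norml; split=> [[]|].
Qed.

Lemma collared_thick_annulus (R : realType) :
  collared (thick (body (annulus R))) (thick (inner (annulus R)))
    (fun x => x.1.2)
    (fun p : ((R * R * R) * R) * R => ((p.1.1.1, p.2), p.1.2)).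
Proof.
split=> //.
- split; first by apply: continuous_snd_comp; exact: continuous_fst.
  have c1 : continuous (fun p : ((R * R * R) * R) * R => p.1).
    exact: continuous_fst.
  apply: continuous_pair; last exact: continuous_snd_comp.
  apply: continuous_pair; last exact: continuous_snd.
  by apply: continuous_fst_comp; exact: continuous_fst_comp.
- by split=> // -[[]].
- by move=> x [[_ x1] _]; rewrite ler_norml.
- by move=> x r [[x1 _] ?]; rewrite ler_norml.
- split=> [x [[x1 x2] x3]|x [/annulus_inner_body]//].
  by rewrite ltr_norml; split=> [[[]]|].
Qed.

Lemma thick_compact (R : realType) (V : normedModType R) (X : set V) :
  compact X -> compact (thick X).
Proof.
move=> cX; have -> : thick X = X `*` `[0, 1].
  by apply/seteqP; split=> -[x z] /=; rewrite /thick /= in_itv.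
by apply: compact_setX => //; exact: segment_compact.
Qed.

Lemma thick_inclusion_eq (R : realType) (x y : (R * R * R) * R) :
  thick (body (annulus R)) x -> thick (body (annulus R)) y ->
  thick_inclusion x = thick_inclusion y ->
  x = y \/ (~ thick (inner (annulus R)) x /\ ~ thick (inner (annulus R)) y).
Proof.
case: x y => [x z] [y w] [bx _] [by_ _] xy.
have E : inclusion x = inclusion y := congr1 fst xy.
have <- : z = w := congr1 snd xy.
have [->|[nx ny]] := @inclusion_eq R x y bx by_ E; first by left.
by right; split=> -[].
Qed.

Lemma thick_inclusion_surj (R : realType) :
  @thick_inclusion R @` thick (body (annulus R)) = thick (body (torus R)).
Proof.
apply/seteqP; split=> [_ [[x z] [/= bx z01] <-]|[w z] [bw z01]].
  by split=> //; exact: inclusion_body.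
have [x bx xw] : (@inclusion R @` body (annulus R)) w by rewrite inclusion_surj.
by exists (x, z) => //; rewrite /thick_inclusion /= xw.
Qed.

(** The isotopy is replaced by one that agrees with it on [C] and is the identity on the boundary;
    the replacement is compatible with the gluing. *)
Lemma inclusion_isotopy (R : realType) (C : set (R * R * R))
    (h : R -> R * R * R -> R * R * R) :
  isotopy (body (annulus R)) (inner (annulus R)) h ->
  compact C -> C `<=` inner (annulus R) ->
  exists K, isotopy (body (torus R)) (inner (torus R)) K /\
    forall t x, 0 <= t <= 1 -> C x -> K t (inclusion x) = inclusion (h t x).
Proof.
move=> iso cC CI.
have [k [ik kfix kC]] := collar_isotopy (@collared_annulus R) iso cC CI.
have [K []] := isotopy_descend (@compact_annulus R) (@inclusion_continuous R)
  (@inclusion_eq R) ik kfix.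
rewrite inclusion_surj => iK KE; exists K; split=> // t x t01 Cx.
by rewrite KE ?kC//; apply: annulus_inner_body; exact: CI.
Qed.

Lemma thick_inclusion_descend (R : realType) k :
  isotopy (thick (body (annulus R))) (thick (inner (annulus R))) k ->
  (forall t x, 0 <= t <= 1 -> thick (body (annulus R)) x ->
    ~ thick (inner (annulus R)) x -> k t x = x) ->
  exists K, isotopy (thick (body (torus R))) (thick (inner (torus R))) K /\
    forall t x, 0 <= t <= 1 -> thick (body (annulus R)) x ->
      K t (thick_inclusion x) = thick_inclusion (k t x).
Proof.
move=> ik kfix; have [K []] := isotopy_descend (thick_compact (@compact_annulus R))
  (@thick_inclusion_continuous R) (@thick_inclusion_eq R) ik kfix.
by rewrite thick_inclusion_surj => iK KE; exists K.
Qed.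

Lemma thick_inclusion_isotopy (R : realType) (C : set ((R * R * R) * R)) h :
  isotopy (thick (body (annulus R))) (thick (inner (annulus R))) h ->
  compact C -> C `<=` thick (inner (annulus R)) ->
  exists K, isotopy (thick (body (torus R))) (thick (inner (torus R))) K /\
    forall t x, 0 <= t <= 1 -> C x ->
      K t (thick_inclusion x) = thick_inclusion (h t x).
Proof.
move=> iso cC CI.
have [k [ik kfix kC]] := collar_isotopy (@collared_thick_annulus R) iso cC CI.
have [K [iK KE]] := thick_inclusion_descend ik kfix.
exists K; split=> // t x t01 Cx; rewrite KE ?kC//.
by have [/annulus_inner_body ? ?] := CI _ Cx.
Qed.

Lemma isotopy_move_inclusion (R : realType) (D D' : prediagram (R * R * R)%type) :
  is_diagram (annulus R) D -> isotopy_move (annulus R) D D' ->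
  isotopy_move (torus R) (map_diagram (@inclusion R) D)
    (map_diagram (@inclusion R) D').
Proof.
move=> [imD iD _ _ _] [h [s [f [ih sf hD oD]]]].
have [|K [iK KE]] := inclusion_isotopy ih (compact_curves imD).
  by move=> _ [x dx <-]; exact: iD.
exists K, s, f; split=> //.
  move=> x dx; rewrite {2}/dpt /pt /= KE ?lexx ?ler01//; last by exists x.
  by rewrite -[crv _ _ _]/(dpt D x) -hD.
move=> x [y [dx dy nxy E]]; apply: oD; exists y; split=> //.
by apply: inclusion_inj E; exact: iD.
Qed.

(** The chart of the disc composed with the inclusion serves in the torus: by injectivity on the
    open annulus no further part of the diagram enters the disc and no further crossing appears. *)
Lemma tangle_move_inclusion (R : realType) (m : nat) (T T' : tangle R m)
    (D D' : prediagram (R * R * R)%type) :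
  is_diagram (annulus R) D -> is_diagram (annulus R) D' ->
  tangle_move T T' (annulus R) D D' ->
  tangle_move T T' (torus R) (map_diagram (@inclusion R) D)
    (map_diagram (@inclusion R) D').
Proof.
move=> [_ iD _ _ _] [_ iD' _ _ _].
move=> [e [s [f [comp [a [[ce ei eI eN] sf [ca da ia ea] out inn]]]]]].
have cr x : crossing (map_diagram (@inclusion R) D) x -> crossing D x.
  move=> [y [dx dy nxy E]]; exists y; split=> //.
  by apply: inclusion_inj E; exact: iD.
have cr' x : crossing (map_diagram (@inclusion R) D') x -> crossing D' x.
  move=> [y [dx dy nxy E]]; exists y; split=> //.
  by apply: inclusion_inj E; exact: iD'.
have disc x : pdom x ->
    ((fun p => inclusion (e p)) @` square) (inclusion (dpt D x)) ->
    (e @` square) (dpt D x).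
  move=> dx [p sp E]; exists p => //; apply: inclusion_inj E; last exact: iD.
  by apply: eI; exists p.
exists (fun p => inclusion (e p)), s, f, comp, a; split.
- split.
  + apply: (@within_comp _ _ _ _ setT) ce _ => //.
    by apply: continuous_subspaceT; exact: inclusion_continuous.
  + move=> p p' sp sp' E; apply: (ei p p' sp sp'); apply: inclusion_inj E.
      by apply: eI; exists p => //; exact: set_mem.
    by apply: eI; exists p' => //; exact: set_mem.
  + by move=> _ [p sp <-]; apply/inclusion_body/annulus_inner_body/eI; exists p.
  + move=> x px /disc; apply: contra_not (eN x px); apply.
    by case: px => ->; rewrite /pdom /= ?lexx ?ler01.
- exact: sf.
- by split=> // x dx /(disc _ dx); exact: ea.
- move=> x dx nd; have [|E o] := out x dx.
    by apply: contra_not nd => -[p sp E]; exists p; rewrite // E.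
  by split=> [|/cr //]; rewrite /dpt /pt /=; congr inclusion.
- move=> j u u1; have [E1 o1 E2 o2] := inn j u u1; split.
  + by rewrite -E1.
  + by move/cr; exact: o1.
  + by rewrite -E2.
  + by move/cr'; exact: o2.
Qed.

(** * Rails and multi-knotoids under the thickened inclusion *)

Lemma rail_in_thick (R : realType) (V : normedModType R) (X : set V) (p : V) :
  X p -> rail p `<=` thick X.
Proof. by move=> Xp [x z] [/= -> z01]. Qed.

Lemma rail_compact (R : realType) (V : normedModType R) (p : V) : compact (rail p).
Proof.
have -> : rail p = thick [set p] by apply/seteqP; split=> x [].
exact/thick_compact/compact_set1.
Qed.

Lemma rail_inclusion (R : realType) (p : R * R * R) :
  rail (inclusion p) = @thick_inclusion R @` rail p.
Proof.
apply/seteqP; split=> [[w z] [/= -> z01]|_ [[x z] [/= -> z01] <-]] //.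
by exists (p, z).
Qed.

Lemma rail_image (R : realType) (p p' : R * R * R) (K : _ -> _)
    (h : (R * R * R) * R -> (R * R * R) * R) :
  (forall x, rail p x -> K (thick_inclusion x) = thick_inclusion (h x)) ->
  h @` rail p = rail p' -> K @` rail (inclusion p) = rail (inclusion p').
Proof.
move=> Kh hp; rewrite !rail_inclusion -hp; apply/seteqP; split=> [w|w].
  by move=> [_ [x px <-] <-]; exists (h x); [exists x|rewrite Kh].
by move=> [_ [x px <-] <-]; exists (thick_inclusion x); [exists x|rewrite Kh].
Qed.

(** The bound uses [thick (inner S)] instead of [thick_interior S] because endpoints may lie on the
    top or bottom face. *)
Lemma multi_knotoid_range (R : realType) (V : normedModType R) (S : surface V)
    (K : railed_curves V) (x : kparam K) :
  is_multi_knotoid S K -> pdom x -> thick (inner S) (kpt K x).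
Proof.
move=> [[il ih _] _ _ [r0 r1] iK] dx.
have [|nx] := pselect (pend x); first by case=> ->; [exact: (rail_in_thick il r0)|exact: (rail_in_thick ih r1)].
by have [[? ?] _ _] := iK x dx nx; split=> //; lra.
Qed.

Lemma thick_inclusion_inj (R : realType) (x y : (R * R * R) * R) :
  thick (inner (annulus R)) x -> thick (inner (annulus R)) y ->
  thick_inclusion x = thick_inclusion y -> x = y.
Proof.
move=> ix iy; have [bx z] := ix; have [by_ w] := iy.
move/annulus_inner_body: bx => bx; move/annulus_inner_body: by_ => by_.
by case/(thick_inclusion_eq (conj bx z) (conj by_ w)) => // -[].
Qed.

Lemma is_multi_knotoid_inclusion (R : realType) (K : railed_curves (R * R * R)%type) :
  is_multi_knotoid (annulus R) K ->
  is_multi_knotoid (torus R) (map_railed (@inclusion R) (@thick_inclusion R) K).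
Proof.
move=> mK; have rg x dx := multi_knotoid_range (x := x) mK dx.
have [[il ih lh] [sK nK pK] iK [r0 r1] tK] := mK.
have der i (t : R) : derive1 (crv (map_curves (@thick_inclusion R) (kcrv K)) i) t =
    (d_inclusion (crv (kcrv K) i t).1 (derive1 (crv (kcrv K) i) t).1,
     (derive1 (crv (kcrv K) i) t).2).
  exact: (derive1_thick_inclusion (@smooth_derivable R _ _ t (sK i))).
have norail p x : inner (annulus R) p -> pdom x -> ~ rail p (kpt K x) ->
    ~ rail (inclusion p) (thick_inclusion (kpt K x)).
  move=> ip dx nr; rewrite rail_inclusion => -[y ry E]; apply: nr.
  by rewrite -(thick_inclusion_inj _ _ E)//; [exact: rail_in_thick ry|exact: rg].
split.
- split; [| |by move/inclusion_inj; apply: contra_not lh; apply].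
    exact/inclusion_body/annulus_inner_body.
  exact/inclusion_body/annulus_inner_body.
- split=> [i|x dx|i t]; first exact: smooth_thick_inclusion.
    rewrite der; apply/eqP => E.
    have E1 := d_inclusion_inj (congr1 fst E); have E2 := congr1 snd E.
    move/eqP: (nK x dx); apply.
    by rewrite [LHS]surjective_pairing E1; congr (_, _).
  by rewrite /= pK.
- move=> x y dx dy E; apply: iK => //; apply: thick_inclusion_inj E; exact: rg.
- by split; rewrite rail_inclusion; eexists; eauto.
- move=> x dx nx; have [[i z] nl nh] := tK x dx nx; split.
  + by split=> //; exact/inclusion_body/annulus_inner_body.
  + exact: norail.
  + exact: norail.
Qed.

Lemma carries_inclusion (R : realType) (K K' : railed_curves (R * R * R)%type)
    F F' :
  (forall x : kparam K, pdom x ->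
    F' (thick_inclusion (kpt K x)) = thick_inclusion (F (kpt K x))) ->
  carries F K K' ->
  carries F' (map_railed (@inclusion R) (@thick_inclusion R) K)
    (map_railed (@inclusion R) (@thick_inclusion R) K').
Proof.
move=> FF [s [f [sf E]]]; exists s, f; split=> // x dx.
by rewrite {2}/kpt /pt /= FF// -E.
Qed.

(** A rail-fixing isotopy is already the identity on the boundary and passes to the quotient as it
    is; a rail shift may move the boundary and needs the collar; an endpoint slide changes heights
    only. *)
Lemma rail_move_inclusion (R : realType) (K K' : multi_knotoid (annulus R))
    (L L' : multi_knotoid (torus R)) :
  sval L = map_railed (@inclusion R) (@thick_inclusion R) (sval K) ->
  sval L' = map_railed (@inclusion R) (@thick_inclusion R) (sval K') ->
  rail_move K K' -> rail_move L L'.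
Proof.
case: K K' L L' => [K mK] [K' mK'] [L mL] [L' mL'] /= EL EL'; subst L L'.
have rg x dx := multi_knotoid_range (x := x) mK dx.
have [[il ih lh] imK iK [r0 r1] tK] := mK.
have il' := annulus_inner_body il; have ih' := annulus_inner_body ih.
have one01 : 0 <= (1 : R) <= 1 by rewrite lexx ler01.
case=> /= [[h [hi hfix hr [El Eh] hK]]|[f [cf fi f01 [El Eh] fK]]|].
- have hfix' t x : 0 <= t <= 1 -> thick (body (annulus R)) x ->
      ~ thick (inner (annulus R)) x -> h t x = x.
    move=> t01 bx nx; apply: hfix => // -[ix z]; apply: nx.
    by split=> //; case: bx.
  have [H [iH HE]] := thick_inclusion_descend hi hfix'.
  apply: Move_rail_isotopy; exists H; split=> //=.
  + move=> t w t01; rewrite -thick_inclusion_surj => -[x bx <-] nw.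
    rewrite HE// hfix// => -[ix z]; apply: nw; split=> //.
    exact/inclusion_body/annulus_inner_body.
  + move=> t t01; have [E1 E2] := hr t t01; split.
      by apply: rail_image E1 => x rx; apply: HE => //; exact: rail_in_thick rx.
    by apply: rail_image E2 => x rx; apply: HE => //; exact: rail_in_thick rx.
  + by rewrite El Eh.
  + apply: carries_inclusion hK => x dx; apply: HE => //.
    by have [/annulus_inner_body ? ?] := rg _ dx.
- apply: Move_endpoint_slide; exists f; split=> //=; first by rewrite El Eh.
  exact: carries_inclusion fK.
- move=> [h [p [q [hi hr [El Eh] hK]]]].
  (* The damped isotopy has to agree with [h] on the rails as well as on the curves. *)
  pose C := rail (leg_pt K) `|` rail (head_pt K) `|`
    [set w | exists2 x : kparam K, pdom x & pt x = w].
  have cC : compact C.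
    apply: compactU; last exact: compact_curves.
    by apply: compactU; exact: rail_compact.
  have CI : C `<=` thick (inner (annulus R)).
    move=> w [[|]|[x dx <-]]; [exact: rail_in_thick|exact: rail_in_thick|exact: rg].
  have [H [iH HE]] := thick_inclusion_isotopy hi cC CI.
  apply: Move_rail_shift; exists H, (fun t => inclusion (p t)), (fun t => inclusion (q t)).
  split=> //=.
  + move=> t t01; have [E1 E2] := hr t t01; split.
      by apply: rail_image E1 => x rx; apply: HE => //; left; left.
    by apply: rail_image E2 => x rx; apply: HE => //; left; right.
  + by rewrite El Eh.
  + by apply: carries_inclusion hK => x dx; apply: HE => //; right; exists x.
Qed.

Lemma diagram_move_inclusion (R : realType) (D D' : diagram (annulus R))
    (E E' : diagram (torus R)) :
  sval E = map_diagram (@inclusion R) (sval D) ->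
  sval E' = map_diagram (@inclusion R) (sval D') ->
  diagram_move D D' -> diagram_move E E'.
Proof.
case: D D' E E' => [D dD] [D' dD'] [E dE] [E' dE'] /= EE EE'; subst E E'.
case=> /= [mv|b mv|mv|mv].
- apply: Move_isotopy; exact: isotopy_move_inclusion.
- apply: (Move_R1 (b := b)); exact: tangle_move_inclusion.
- apply: Move_R2; exact: tangle_move_inclusion.
- apply: Move_R3; exact: tangle_move_inclusion.
Qed.

(** * The linking invariant *)

(** The annulus as the planar ring of radii 1 to 3: [x.1] is the direction and [2 + x.2] the
    radius. *)
Definition planar (R : realType) (x : R * R * R) : R * R :=
  ((2 + x.2) * x.1.1, (2 + x.2) * x.1.2).

Lemma planar_continuous (R : realType) : continuous (@planar R).
Proof.
have c2 : continuous (fun x : R * R * R => 2 + x.2).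
  by apply: continuousD_fun; [exact: continuous_cst|exact: continuous_snd].
have c1 : continuous (fun x : R * R * R => x.1) by exact: continuous_fst.
by apply: continuous_pair; apply: continuousM_fun => //;
  [exact: continuous_fst_comp|exact: continuous_snd_comp].
Qed.

Lemma planar_inj (R : realType) (x y : R * R * R) :
  body (annulus R) x -> body (annulus R) y -> planar x = planar y -> x = y.
Proof.
case: x y => [[a b] s] [[c d] t] [/= ab s1] [/= cd t1] [E1 E2].
have st : (2 + s) ^+ 2 = (2 + t) ^+ 2.
  transitivity (((2 + s) * a) ^+ 2 + ((2 + s) * b) ^+ 2).
    by transitivity ((2 + s) ^+ 2 * (a ^+ 2 + b ^+ 2)); [rewrite ab mulr1|ring].
  rewrite E1 E2; transitivity ((2 + t) ^+ 2 * (c ^+ 2 + d ^+ 2)); first ring.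
  by rewrite cd mulr1.
have {}st : s = t.
  apply: (addrI 2); apply/eqP; rewrite -(@eqrXn2 _ 2)//; [exact/eqP|lra|lra].
rewrite -{t}st in t1 E1 E2 *; have n0 : 2 + s != 0 by rewrite gt_eqF//; lra.
by have -> := mulfI n0 E1; have -> := mulfI n0 E2.
Qed.

(** Composing with [f] transports an argument of [G]; the converse composes with the inverse of [f].
    The latter exists because [f] moves by a full unit over each period and is thus onto by the
    intermediate value theorem. *)
Lemma angle_lifts_reparam (R : realType) (f : R -> R) (b : bool) (G : R -> R * R) :
  continuous f -> injective f -> (forall t, f (t + 1) = f t + (-1) ^+ b) ->
  (forall t, G (t + 1) = G t) ->
  angle_lifts (fun u => G (f u)) <-> angle_lifts G.
Proof.
move=> cf fi fP pG.
have step (T : Type) (F : R -> T) : (forall t, F (t + 1) = F t) ->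
    forall u, F (f (u + 1)) = F (f u).
  move=> pF u; rewrite fP; case: (b); last exact: pF.
  by rewrite expr1 -[in RHS](subrK 1 (f u)) pF.
split=> -[phi [cphi pphi tphi sphi]]; last first.
  exists (fun u => phi (f u)); split=> //; first exact: continuous_after.
  exact: step.
have fn (n : nat) t : f (t + n%:R) = f t + (-1) ^+ b * n%:R.
  elim: n t => [|n IH] t; first by rewrite mulr0 !addr0.
  by rewrite -natr1 addrA fP IH; ring.
have fnN (n : nat) t : f (t - n%:R) = f t - (-1) ^+ b * n%:R.
  by rewrite -[in RHS](subrK n%:R t) fn addrK.
have ivt u v y : u <= v -> Num.min (f u) (f v) <= y <= Num.max (f u) (f v) ->
    exists2 x, u <= x <= v & f x = y.
  move=> uv fuv; have cuv : {within `[u, v], continuous f}.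
    exact: continuous_subspaceT.
  have [x xuv fx] := IVT uv cuv fuv.
  by exists x => //; move: xuv; rewrite in_itv.
have fsurj y : exists x, f x = y.
  have [n yn] : exists n : nat, `|y - f 0| <= n%:R.
    exists (Num.truncn `|y - f 0|).+1; apply: ltW; exact: truncnS_gt.
  move: yn; rewrite ler_norml => yn; have n0 : 0 <= n%:R :> R by [].
  suff [x _ <-] : exists2 x, - n%:R <= x <= n%:R & f x = y by exists x.
  apply: ivt; first lra.
  have := fn n 0; have := fnN n 0; rewrite !add0r => -> ->.
  by rewrite ge_min le_max; case: (b); rewrite ?expr1 ?expr0; lra.
have /choice[g gf] := fsurj.
have fK u : g (f u) = u by apply: fi; rewrite gf.
exists (fun y => phi (g y)); split.
(* On the compact interval [x - 1, x + 1] the map [f] is a quotient map onto its image, which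
   contains [y - 1, y + 1]; so [phi] composed with the inverse is continuous at [y]. *)
- move=> y; set x := g y.
  have wc : {within f @` `[x - 1, x + 1], continuous (fun y => phi (g y))}.
    apply: within_quotient.
    + exact: Rhausdorff.
    + exact: segment_compact.
    + exact: continuous_subspaceT.
    + apply: (@within_eq _ _ _ phi) => [u _|]; first by rewrite fK.
      exact: continuous_subspaceT.
  have sub : `[y - 1, y + 1] `<=` f @` `[x - 1, x + 1].
    move=> z /=; rewrite in_itv /= => zy.
    suff [w wx <-] : exists2 w, x - 1 <= w <= x + 1 & f w = z.
      by exists w; rewrite //= in_itv.
    apply: ivt; first lra.
    have := fn 1%N x; have := fnN 1%N x => -> ->; rewrite gf.
    by rewrite ge_min le_max; case: (b); rewrite ?expr1 ?expr0; lra.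
  have : {within `]y - 1, y + 1[, continuous (fun y => phi (g y))}.
    apply: continuous_subspaceW wc => z zy; apply: sub; exact: subset_itv_oo_cc.
  rewrite continuous_open_subspace; last exact: interval_open.
  by apply; rewrite inE /= in_itv /=; lra.
- move=> y; have [u <-] := fsurj y; rewrite fK.
  have E1 : f (u + (-1) ^+ b) = f u + 1.
    case: (b) fn fnN fP => fn fnN fP.
      by rewrite expr1 -[u - 1]/(u - 1%:R) fnN; ring.
    by rewrite expr0 fP expr0.
  rewrite -E1 fK; case: (b); last exact: pphi.
  by rewrite expr1 -[in RHS](subrK 1 u) pphi.
- by move=> y; have := tphi (g y); rewrite gf.
- by move=> y; have := sphi (g y); rewrite gf.
Qed.

(** Every circle has winding number zero about the leg in the planar ring. *)
Definition circles_unlinked (R : realType) (n : nat)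
    (c : option 'I_n -> R -> R * R * R) : Prop :=
  forall i : 'I_n, angle_lifts (fun u => planar (c (Some i) u) - planar (c None 0)).

(** The common criterion for all moves: for each circle, a homotopy in the punctured plane from
    circle minus leg to the corresponding reparametrized difference. The bijection [s] then matches
    the circles of both sides. *)
Lemma circles_unlinked_homotopy (R : realType) (n n' : nat)
    (c : option 'I_n -> R -> R * R * R) (c' : option 'I_n' -> R -> R * R * R) s f :
  reparam s f ->
  (forall (i : 'I_n') t, c' (Some i) (t + 1) = c' (Some i) t) ->
  (forall i : 'I_n, exists H : R * R -> R * R,
     [/\ continuous H, forall t u, H (t, u + 1) = H (t, u),
         forall t u, H (t, u) <> 0,
         forall u, H (0, u) = planar (c (Some i) u) - planar (c None 0)
       & forall u, H (1, u) =
           planar (c' (s (Some i)) (f (Some i) u)) - planar (c' None 0)]) ->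
  circles_unlinked c <-> circles_unlinked c'.
Proof.
move=> [[sb sN] cf _ fP] pc' hom.
have sS (i : 'I_n) : exists j, s (Some i) = Some j.
  case E : (s (Some i)) => [j|]; first by exists j.
  by have := bij_inj sb; rewrite -sN in E => /(_ _ _ E).
have key (i : 'I_n) j : s (Some i) = Some j ->
    angle_lifts (fun u => planar (c (Some i) u) - planar (c None 0)) <->
    angle_lifts (fun u => planar (c' (Some j) u) - planar (c' None 0)).
  move=> sij; have [H [cH pH nH H0 H1]] := hom i; have [b fb] := fP i.
  have [cfi fi] := cf (Some i).
  rewrite -(@angle_lifts_reparam R _ b
    (fun u => planar (c' (Some j) u) - planar (c' None 0)) cfi fi fb); last first.
    by move=> t; rewrite pc'.
  have -> : (fun u => planar (c (Some i) u) - planar (c None 0)) =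
      (fun u => H (0, u)) by apply/funext => u; rewrite H0.
  have -> : (fun u => planar (c' (Some j) (f (Some i) u)) - planar (c' None 0)) =
      (fun u => H (1, u)) by apply/funext => u; rewrite H1 sij.
  by split; exact: angle_lifts_homotopy.
split=> U i.
  have [g gs sg] := sb; have := sg (Some i); case: (g (Some i)) => [j sj|].
    by apply/(key j i sj); exact: U.
  by rewrite sN.
have [j sj] := sS i; by apply/(key i j sj); exact: U.
Qed.

(** A retraction of the line onto [0, 1]: isotopies are controlled only for times in [0, 1], whereas
    [angle_lifts_homotopy] wants a homotopy over the whole line. *)
Definition unit_clamp (R : realType) (t : R) : R := `|clamp 1 t|.

Lemma unit_clamp_continuous (R : realType) : continuous (@unit_clamp R).
Proof.
exact: (continuous_after (@norm_continuous R R) (@clamp_continuous R 1)).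
Qed.

Lemma unit_clampP (R : realType) (t : R) : 0 <= unit_clamp t <= 1.
Proof.
rewrite /unit_clamp normr_ge0 /= ler_norml.
by have [[? ->]|[? ->]|[? ->]] := clampP t ler01; lra.
Qed.

Lemma unit_clamp0 (R : realType) : unit_clamp (0 : R) = 0.
Proof.
rewrite /unit_clamp; have [[? ->]|[? ->]|[? ->]] := clampP (0 : R) ler01; [|lra|lra].
by rewrite normr0.
Qed.

Lemma unit_clamp1 (R : realType) : unit_clamp (1 : R) = 1.
Proof.
rewrite /unit_clamp; have [[? ->]|[? ->]|[? ->]] := clampP (1 : R) ler01; [|lra|lra].
by rewrite normr1.
Qed.

Lemma subr_neq0P (R : realType) (a b : R * R) : a <> b -> a - b <> 0.
Proof. by move=> ab /eqP; rewrite subr_eq0 => /eqP. Qed.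

Lemma continuous_subr (R : realType) (T : topologicalType) (f g : T -> R * R) :
  continuous f -> continuous g -> continuous (fun x => f x - g x).
Proof. by move=> cf cg x; apply: cvgB; [exact: cf|exact: cg]. Qed.

Lemma curve_homotopy_continuous (R : realType) (W : normedModType R)
    (X : set W) (h : R -> W -> W) (c : R -> W) :
  {within [set p : R * W | 0 <= p.1 <= 1 /\ X p.2],
    continuous (fun p : R * W => h p.1 p.2)} ->
  continuous c -> (forall u, X (c u)) ->
  continuous (fun p : R * R => h (unit_clamp p.1) (c p.2)).
Proof.
move=> ch cc Xc.
apply: (@within_total _ _ _ _ (fun p : R * R => (unit_clamp p.1, c p.2)) _ _ _ ch).
  by move=> p; split; [exact: unit_clampP|exact: Xc].
apply: continuous_pair.
  by apply: (continuous_after (@unit_clamp_continuous R)); exact: continuous_fst.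
by apply: (continuous_after cc); exact: continuous_snd.
Qed.

(** Circle and leg are moved together. They are disjoint at the start because an endpoint is never a
    double point, and they stay so because each stage of the isotopy is injective. *)
Lemma isotopy_move_unlinked (R : realType) (D D' : prediagram (R * R * R)%type) :
  is_diagram (annulus R) D -> is_diagram (annulus R) D' ->
  isotopy_move (annulus R) D D' ->
  circles_unlinked (crv (dcrv D)) <-> circles_unlinked (crv (dcrv D')).
Proof.
move=> [[sD _ pD] iD dD _ _] [[_ _ pD'] _ _ _ _].
move=> [h [s [f [/isotopyP[g [h0 ch _ hX _]] sf hD _]]]].
apply: (circles_unlinked_homotopy sf pD') => i.
have [[_ sN] _ [f0 _] _] := sf.
have bi u : body (annulus R) (crv (dcrv D) (Some i) u).
  by apply: annulus_inner_body; exact: (iD (Some i, u)).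
have b0 : body (annulus R) (crv (dcrv D) None 0).
  by apply: annulus_inner_body; apply: (iD (None, 0)); rewrite /pdom /= lexx ler01.
have z01 : 0 <= (0 : R) <= 1 by rewrite lexx ler01.
have one01 : 0 <= (1 : R) <= 1 by rewrite lexx ler01.
exists (fun p => planar (h (unit_clamp p.1) (crv (dcrv D) (Some i) p.2)) -
  planar (h (unit_clamp p.1) (crv (dcrv D) None 0))); split.
- apply: continuous_subr; apply: (continuous_after (@planar_continuous R)).
    apply: (curve_homotopy_continuous ch) => //.
    exact: (smooth_continuous (sD (Some i))).
  apply: (curve_homotopy_continuous ch (c := fun=> crv (dcrv D) None 0)) => //.
  exact: continuous_cst.
- by move=> t u /=; rewrite pD.
- move=> t u /=; apply: subr_neq0P.
  have t01 := unit_clampP t.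
  have [X1 g1 _ _] := hX _ _ t01 (bi u); have [X2 g2 _ _] := hX _ _ t01 b0.
  move/(planar_inj X1 X2)/(congr1 (g (unit_clamp t))); rewrite g1 g2 => E.
  have [] := dD (None, 0) (Some i, u); last by case; left.
  by split=> //; case.
- by move=> u /=; rewrite unit_clamp0 !h0.
- move=> u /=; rewrite unit_clamp1.
  have := hD (Some i, u) Logic.I; have := hD (None, 0) z01.
  rewrite /dpt /pt /preparam /= sN f0 => -> E.
  by congr (planar _ - _); rewrite -E.
Qed.

Lemma square_convex (R : realType) (p q : R * R) (t : R) :
  0 <= t <= 1 -> square p -> square q -> square ((1 - t) *: p + t *: q).
Proof.
case: p q => [a b] [c d] t01 [/= a1 b1] [/= c1 d1].
have conv (x y : R) : -1 <= x <= 1 -> -1 <= y <= 1 -> -1 <= (1 - t) * x + t * y <= 1.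
  move=> x1 y1.
  have p1 : 0 <= (1 - t) * (1 - x) by apply: mulr_ge0; lra.
  have p2 : 0 <= (1 - t) * (1 + x) by apply: mulr_ge0; lra.
  have p3 : 0 <= t * (1 - y) by apply: mulr_ge0; lra.
  have p4 : 0 <= t * (1 + y) by apply: mulr_ge0; lra.
  lra.
by split; exact: conv.
Qed.

Lemma compact_square (R : realType) : compact (@square R).
Proof.
have -> : @square R = `[-1, 1] `*` `[-1, 1].
  by apply/seteqP; split=> -[x y] /=; rewrite /square /= !in_itv.
by apply: compact_setX; exact: segment_compact.
Qed.

(* Inside the disc the homotopy is the straight one in the square; at points
   where a curve enters the disc both curves agree, so the two pieces match. *)
Lemma disc_homotopy (R : realType) (V : normedModType R) (e : R * R -> V)
    (c d : R -> V) :
  {within square, continuous e} -> set_inj square e ->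
  continuous c -> continuous d ->
  (forall u, ~ (e @` square) (c u) -> d u = c u) ->
  (forall u, (e @` square) (c u) -> (e @` square) (d u)) ->
  exists G : R * R -> V,
    [/\ continuous G, forall t u v, c u = c v -> d u = d v -> G (t, u) = G (t, v),
        forall u, G (0, u) = c u /\ G (1, u) = d u
      & forall t u, (e @` square) (G (t, u)) \/
          (~ (e @` square) (c u) /\ G (t, u) = c u)].
Proof.
move=> ce ei cc cd out inn; pose disc := e @` square.
(* [E] inverts the chart on the disc, with default value 0 outside. *)
have /choice[E EP] : forall x, exists p, disc x -> square p /\ e p = x.
  move=> x; have [[p sp ep]|nx] := pselect (disc x); first by exists p.
  by exists 0.
have EK p : square p -> E (e p) = p.
  move=> sp; have [|s1 e1] := EP (e p); first by exists p.
  by apply: ei; rewrite ?inE.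
have cE : {within disc, continuous E}.
  apply: within_quotient.
  - exact: norm_hausdorff.
  - exact: compact_square.
  - exact: ce.
  - apply: (@within_eq _ _ _ id) => [p sp|]; first by rewrite EK.
    by apply: continuous_subspaceT; exact: continuous_id.
have cldisc : closed disc.
  apply: compact_closed; first exact: norm_hausdorff.
  by apply: continuous_compact => //; exact: compact_square.
pose L (t : R) u := (1 - unit_clamp t) *: E (c u) + unit_clamp t *: E (d u).
have sL t u : disc (c u) -> square (L t u).
  move=> cu; have [s1 _] := EP _ cu; have [s2 _] := EP _ (inn u cu).
  by apply: square_convex => //; exact: unit_clampP.
pose G (p : R * R) := if `[< disc (c p.2) >] then e (L p.1 p.2) else c p.2.
have cc2 : continuous (fun p : R * R => c p.2).
  by apply: (continuous_after cc); exact: continuous_snd.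
have cd2 : continuous (fun p : R * R => d p.2).
  by apply: (continuous_after cd); exact: continuous_snd.
pose A := [set p : R * R | disc (c p.2)]; pose B := closure (~` A).
have clA : closed A by exact: (closed_comp _ cldisc) => p _; exact: cc2.
exists G; split.
- apply/continuous_subspace_setT.
  have -> : [set: R * R] = A `|` B.
    apply/seteqP; split=> // p _; have [|np] := pselect (A p); first by left.
    by right; exact: subset_closure.
  apply: withinU_continuous => //; first exact: closed_closure.
    apply: (@within_eq _ _ _ (fun p : R * R => e (L p.1 p.2))).
      by move=> p Ap; rewrite /G; case: asboolP.
    apply: (@within_comp _ _ _ A square (fun p : R * R => L p.1 p.2) e) => //.
      by move=> p Ap; exact: sL.
    have ct : continuous (fun p : R * R => unit_clamp p.1).
      by apply: (continuous_after (@unit_clamp_continuous R)); exact: continuous_fst.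
    have c1 : {within A, continuous (fun p : R * R => E (c p.2))}.
      apply: (@within_comp _ _ _ A disc (fun p : R * R => c p.2) E) => //.
      exact: continuous_subspaceT.
    have c2 : {within A, continuous (fun p : R * R => E (d p.2))}.
      apply: (@within_comp _ _ _ A disc (fun p : R * R => d p.2) E) => //.
        by move=> p Ap; exact: inn.
      exact: continuous_subspaceT.
    have c3 := continuous_subspaceT (A := A) ct.
    move=> p; apply: cvgD; apply: cvgZ; [|exact: c1|exact: c3|exact: c2].
    by apply: cvgB; [exact: cvg_cst|exact: c3].
  apply: (@within_eq _ _ _ (fun p : R * R => c p.2)); last exact: continuous_subspaceT.
  move=> p Bp; rewrite /G; case: asboolP => // cp.
  have dc : d p.2 = c p.2.
    pose Z := [set p : R * R | d p.2 - c p.2 = 0].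
    have clZ : closed Z.
      apply: (closed_comp (f := fun p : R * R => d p.2 - c p.2) (D := [set 0])).
        by move=> q _; apply: cvgB; [exact: cd2|exact: cc2].
      apply: accessible_closed_set1; exact/hausdorff_accessible/norm_hausdorff.
    have : Z p.
      rewrite (closure_id Z).1//; apply: closureS Bp => q /= nq.
      by rewrite /Z /= out ?subrr.
    by move/eqP; rewrite subr_eq0 => /eqP.
  rewrite /L dc -scalerDl subrK scale1r.
  by have [_ ->] := EP _ cp.
- by move=> t u v cuv duv; rewrite /G /L /= cuv duv.
- move=> u; rewrite /G /L /= unit_clamp0 unit_clamp1; case: asboolP => cu.
    rewrite subr0 subrr !scale1r !scale0r addr0 add0r.
    by have [_ ->] := EP _ cu; have [_ ->] := EP _ (inn u cu).
  by rewrite out.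
- move=> t u; rewrite /G /=; case: asboolP => cu; last by right.
  by left; exists (L t u) => //; exact: sL.
Qed.

(** The leg lies outside the disc and does not move. The homotopy of a circle stays in the disc or
    leaves the point where it was, so it never meets the leg. *)
Lemma tangle_move_unlinked (R : realType) (m : nat) (T T' : tangle R m)
    (D D' : prediagram (R * R * R)%type) :
  is_diagram (annulus R) D -> is_diagram (annulus R) D' ->
  (forall j u, -1 <= u <= 1 -> square (strand T' j u)) ->
  tangle_move T T' (annulus R) D D' ->
  circles_unlinked (crv (dcrv D)) <-> circles_unlinked (crv (dcrv D')).
Proof.
move=> [[sD _ pD] iD dD _ _] [[sD' _ pD'] _ _ _ _] sq.
move=> [e [s [f [comp [a [[ce ei eI eN] sf [_ _ _ ea] out inn]]]]]].
apply: (circles_unlinked_homotopy sf pD') => i.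
have [[sb sN] cf [f0 _] fP] := sf.
have z01 : 0 <= (0 : R) <= 1 by rewrite lexx ler01.
pose leg := crv (dcrv D) None 0.
have bi u : body (annulus R) (crv (dcrv D) (Some i) u).
  by apply: annulus_inner_body; exact: (iD (Some i, u)).
have b0 : body (annulus R) leg by apply: annulus_inner_body; exact: (iD (None, 0)).
have ndleg : ~ (e @` square) leg by apply: (eN (None, 0)); left.
have nleg u : crv (dcrv D) (Some i) u <> leg.
  move=> E; have [] := dD (None, 0) (Some i, u); last by case; left.
  by split=> //; case.
pose d u := crv (dcrv D') (s (Some i)) (f (Some i) u).
have dP u : d (u + 1) = d u.
  rewrite /d; have [b ->] := fP i.
  case E : (s (Some i)) => [j|].
    by case: b; rewrite ?expr0 ?expr1 ?pD'// -[in RHS](subrK 1 (f (Some i) u)) pD'.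
  by have := bij_inj sb; rewrite -sN in E => /(_ _ _ E).
have cd : continuous d.
  apply: (continuous_after (smooth_continuous (sD' _))).
  by have [] := cf (Some i).
have din u : (e @` square) (crv (dcrv D) (Some i) u) -> (e @` square) (d u).
  move=> /(ea (Some i, u) Logic.I)[j [v [v1 [/= ci [z uz]]]]].
  (* The strand gives the parameter only up to an integer, which periodicity of [d] absorbs. *)
  have [_ _ E _] := inn j v v1.
  exists (strand T' j v); first exact: sq.
  rewrite -E /dpt /pt /preparam /= -ci -/(d (a j v)).
  by rewrite -[RHS]/(d u) -[u](subrK (a j v)) uz addrC (periodic_int dP).
have dout u : ~ (e @` square) (crv (dcrv D) (Some i) u) ->
    d u = crv (dcrv D) (Some i) u.
  by move=> nd; have [] := out (Some i, u) Logic.I nd.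
have [G [cG GP G01 Gd]] := disc_homotopy ce ei
  (smooth_continuous (sD (Some i))) cd dout din.
exists (fun p => planar (G p) - planar leg); split.
- apply: continuous_subr; last exact: continuous_cst.
  exact: (continuous_after (@planar_continuous R)).
- by move=> t u; rewrite (GP t (u + 1) u)// pD.
- move=> t u; apply: subr_neq0P => E; case: (Gd t u) => [Gin|[_ Gc]].
    apply: ndleg; rewrite -(planar_inj _ _ E)//.
    exact/annulus_inner_body/eI.
  by apply: (nleg u); apply: planar_inj => //; rewrite -Gc.
- by move=> u; have [-> _] := G01 u.
- move=> u; have [_ ->] := G01 u; congr (_ - planar _).
  by have [] := out (None, 0) z01 ndleg; rewrite /dpt /pt /preparam /= sN f0.
Qed.

Lemma R1_kink_square (R : realType) b j (u : R) :
  -1 <= u <= 1 -> square (strand (R1_kink R b) j u).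
Proof.
move=> u1; split=> /=; last by apply/andP; split; nra.
have p : 0 <= (1 - u) * (1 + u) by apply: mulr_ge0; lra.
(* The product is 1 + 3u - 4u^3; together with u <= 1 it yields 2u^3 - u <= 1. The next product is
   its mirror image, for the lower bound. *)
have q : 0 <= (1 - u) * (1 + 2 * u) ^+ 2.
  by apply: mulr_ge0; [lra|exact: sqr_ge0].
have q' : 0 <= (1 + u) * (1 - 2 * u) ^+ 2.
  by apply: mulr_ge0; [lra|exact: sqr_ge0].
by apply/andP; split; nra.
Qed.

Lemma R2_overlap_square (R : realType) j (u : R) :
  -1 <= u <= 1 -> square (strand (R2_overlap R) j u).
Proof.
move=> u1; have p : 0 <= (1 - u) * (1 + u) by apply: mulr_ge0; lra.
have p2 := sqr_ge0 u.
have q : u ^+ 2 <= 1 by nra.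
by split=> //=; case: ifP => _; lra.
Qed.

Lemma R3_square (R : realType) b j (u : R) :
  -1 <= u <= 1 -> square (strand (R3_tangle R b) j u).
Proof.
move=> u1; have p : 0 <= (1 - u) * (1 + u) by apply: mulr_ge0; lra.
have p2 := sqr_ge0 u.
have q : u ^+ 2 <= 1 by nra.
rewrite /square /=; case: ifP => _; first by split.
case: ifP => _; first by split=> //=; lra.
by split=> //=; case: b; rewrite ?expr0 ?expr1; lra.
Qed.

Lemma diagram_move_unlinked (R : realType) (D D' : diagram (annulus R)) :
  diagram_move D D' ->
  circles_unlinked (crv (dcrv (sval D))) <-> circles_unlinked (crv (dcrv (sval D'))).
Proof.
have [iD iD'] := (proj2_sig D, proj2_sig D').
case=> [mv|b mv|mv|mv].
- exact: isotopy_move_unlinked mv.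
- by apply: tangle_move_unlinked mv => //; exact: R1_kink_square.
- by apply: tangle_move_unlinked mv => //; exact: R2_overlap_square.
- by apply: tangle_move_unlinked mv => //; exact: R3_square.
Qed.

(** The winding number is read off the projection to the annulus: a point of the thickened annulus
    lies off the leg rail exactly when its projection differs from the leg point. *)
Definition railed_unlinked (R : realType) (K : railed_curves (R * R * R)%type) : Prop :=
  circles_unlinked (fun i u => (crv (kcrv K) i u).1).

(** [p] is the path of the leg rail: constant for a rail-fixing isotopy, arbitrary for a shift.
    Since the rail is carried to vertical rails, a moved circle whose projection hit [p t] would
    meet the image of the rail, against injectivity of [h t]. *)
Lemma rail_isotopy_unlinked (R : realType) (K K' : railed_curves (R * R * R)%type)
    h (p : R -> R * R * R) :
  is_multi_knotoid (annulus R) K -> is_multi_knotoid (annulus R) K' ->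
  isotopy (thick (body (annulus R))) (thick (inner (annulus R))) h ->
  (forall t, 0 <= t <= 1 -> h t @` rail (leg_pt K) = rail (p t)) ->
  leg_pt K' = p 1 -> carries (h 1) K K' ->
  railed_unlinked K <-> railed_unlinked K'.
Proof.
move=> mK [_ [_ _ pK'] _ [[l'E _] _] _] /isotopyP[g [h0 ch _ hX _]] hr lp [s [f [sf hK]]].
have rg x dx := multi_knotoid_range (x := x) mK dx.
have [[il _ _] [sK _ pK] _ [[lE _] _] tK] := mK.
have tb x : thick (inner (annulus R)) x -> thick (body (annulus R)) x.
  by move=> [/annulus_inner_body].
have z01 : 0 <= (0 : R) <= 1 by rewrite lexx ler01.
have one01 : 0 <= (1 : R) <= 1 by rewrite lexx ler01.
(* Any height would do: the image of the rail at time [t] projects to the single point [p t]. *)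
pose leg := (leg_pt K, 0 : R).
have rleg : rail (leg_pt K) leg by split.
have bleg : thick (body (annulus R)) leg by apply/tb; exact: rail_in_thick rleg.
apply: (circles_unlinked_homotopy sf) => [i t|i]; first by rewrite pK'.
have bi u : thick (body (annulus R)) (crv (kcrv K) (Some i) u).
  by apply: tb; exact: (rg (Some i, u)).
exists (fun q => planar (h (unit_clamp q.1) (crv (kcrv K) (Some i) q.2)).1 -
  planar (h (unit_clamp q.1) leg).1); split.
- apply: continuous_subr; apply: (continuous_after (@planar_continuous R));
    apply: continuous_fst_comp.
    apply: (curve_homotopy_continuous ch) => //.
    exact: (smooth_continuous (sK (Some i))).
  apply: (curve_homotopy_continuous ch (c := fun=> leg)) => //.
  exact: continuous_cst.
- by move=> t u /=; rewrite pK.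
- move=> t u /=; apply: subr_neq0P; have t01 := unit_clampP t.
  have [X1 g1 _ _] := hX _ _ t01 (bi u); have [X2 _ _ _] := hX _ _ t01 bleg.
  move/(planar_inj X1.1 X2.1) => E.
  have [_ nl _] := tK (Some i, u) Logic.I (fun e => match e with
    | or_introl e => ltac:(discriminate e) | or_intror e => ltac:(discriminate e) end).
  apply: nl.
  have : (h (unit_clamp t) @` rail (leg_pt K)) (h (unit_clamp t) (crv (kcrv K) (Some i) u)).
    rewrite (hr _ t01); split; last by case: X1.
    rewrite E; have : (h (unit_clamp t) @` rail (leg_pt K)) (h (unit_clamp t) leg).
      by exists leg.
    by rewrite (hr _ t01) => -[].
  move=> [w rw hw].
  have bw : thick (body (annulus R)) w by apply/tb; exact: rail_in_thick rw.
  by have [_ gw _ _] := hX _ _ t01 bw; rewrite /kpt /pt /= -g1 -hw gw.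
- by move=> u /=; rewrite unit_clamp0 !h0//; congr (_ - planar _); exact: esym lE.
- move=> u /=; rewrite unit_clamp1; have := hK (Some i, u) Logic.I.
  rewrite /kpt /pt /preparam /= => <-; congr (_ - planar _).
  transitivity (p 1).
    have : (h 1 @` rail (leg_pt K)) (h 1 leg) by exists leg.
    by rewrite hr// => -[].
  by rewrite -lp; exact: esym l'E.
Qed.

(** Only heights change, so up to reparametrization the projections agree and the constant homotopy
    suffices. *)
Lemma endpoint_slide_unlinked (R : realType) (K K' : railed_curves (R * R * R)%type) :
  is_multi_knotoid (annulus R) K -> is_multi_knotoid (annulus R) K' ->
  endpoint_slide K K' -> railed_unlinked K <-> railed_unlinked K'.
Proof.
move=> mK [_ [_ _ pK'] _ [[l'E _] _] _] [v [_ _ _ [Kl _] [s [f [sf hK]]]]].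
have rg x dx := multi_knotoid_range (x := x) mK dx.
have [[il _ _] [sK _ pK] _ [[lE _] _] tK] := mK.
apply: (circles_unlinked_homotopy sf) => [i t|i]; first by rewrite pK'.
exists (fun q => planar (crv (kcrv K) (Some i) q.2).1 - planar (leg_pt K)); split.
- apply: continuous_subr; last exact: continuous_cst.
  apply: (continuous_after (@planar_continuous R)); apply: continuous_fst_comp.
  apply: (continuous_after (smooth_continuous (sK (Some i)))).
  exact: continuous_snd.
- by move=> t u /=; rewrite pK.
- move=> t u /=; apply: subr_neq0P => E.
  have [[ic z] nl _] := tK (Some i, u) Logic.I (fun e => match e with
    | or_introl e => ltac:(discriminate e) | or_intror e => ltac:(discriminate e) end).
  apply: nl; split; last by lra.
  by apply: planar_inj E; exact: annulus_inner_body.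
- by move=> u /=; congr (_ - planar _); exact: esym lE.
- move=> u /=; have := hK (Some i, u) Logic.I.
  rewrite /kpt /pt /preparam /= => ->; congr (_ - planar _).
  by rewrite -Kl; exact: esym l'E.
Qed.

Lemma rail_move_unlinked (R : realType) (K K' : multi_knotoid (annulus R)) :
  rail_move K K' -> railed_unlinked (sval K) <-> railed_unlinked (sval K').
Proof.
have [mK mK'] := (proj2_sig K, proj2_sig K').
case=> [[h [hi _ hr [El _] hK]]|mv|[h [p [q [hi hr [El _] hK]]]]].
- by apply: (rail_isotopy_unlinked (p := fun=> leg_pt (sval K))) hK => // t /hr[].
- exact: endpoint_slide_unlinked mv.
- by apply: (rail_isotopy_unlinked (p := p)) hK => // t /hr[].
Qed.

Lemma classes_invariant (T : Type) (e : T -> T -> Prop) (P : T -> Prop) (x y : T) :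
  (forall x y, e x y -> P x <-> P y) -> class_of e x = class_of e y -> P x <-> P y.
Proof.
move=> eP xy; elim: (class_of_inj xy) => [u v uv|u|u v _ uv|u v w _ uv _ vw] //.
- exact: eP uv.
- by split=> /uv.
- by split=> [/uv/vw|/vw/uv].
Qed.

(** * The two examples *)

(** [l] is the level of the leg, from which the spoke runs outward over a length 1/4, and [b] is the
    level of the circle. *)
Definition spoke_and_core (R : realType) (l b : R) : curves (R * R * R)%type :=
  {| ncirc := 1;
     crv := fun i t =>
       if i is Some _ then ((cos (2 * pi * t), sin (2 * pi * t)), b)
       else ((1, 0), l + t * (1 / 4)) |}.

Lemma cos_sin_turn (R : realType) (t : R) :
  cos (2 * pi * (t + 1)) = cos (2 * pi * t) /\
  sin (2 * pi * (t + 1)) = sin (2 * pi * t).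
Proof.
have -> : 2 * pi * (t + 1) = 2 * pi * t + pi *+ 2 by rewrite -mulr_natr; ring.
by rewrite cosD2pi sinD2pi.
Qed.

Lemma cos_sin_turn_inj (R : realType) (t u : R) :
  cos (2 * pi * t) = cos (2 * pi * u) -> sin (2 * pi * t) = sin (2 * pi * u) ->
  exists z : int, t - u = z%:~R.
Proof.
move=> ctu stu; have [z z01 E] := fractional_part (t - u).
pose r := t - u - z%:~R.
have cr : cos (2 * pi * r) = 1.
  transitivity (cos (2 * pi * (t - u))).
    rewrite [in RHS]E -/r (periodic_int (f := fun x => cos (2 * pi * x)))//.
    by move=> x; have [] := cos_sin_turn x.
  by rewrite mulrBr cosB ctu stu -!expr2 cos2Dsin2.
have sr : sin (2 * pi * r) = 0 by apply: cos1sin0; rewrite cr normr1.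
(* As [2 * pi * r] has cosine 1, the numbers [2 * r - 1] and 1 both represent the angle pi; hence
   [r] is 0 or 1. *)
have [| |||r1|[r1 _]] := @cos_sin_eq R (2 * r - 1) 1.
- by rewrite /r; lra.
- by lra.
- have -> : pi * (2 * r - 1) = 2 * pi * r - pi by ring.
  by rewrite cosB cr sr cospi mulr1 cospi; ring.
- have -> : pi * (2 * r - 1) = 2 * pi * r - pi by ring.
  by rewrite sinB cr sr sinpi mulr1 sinpi; ring.
- exists (z + 1); rewrite intrD; rewrite /r in r1; lra.
- case: (norm1_cases r1) => {}r1; rewrite /r in r1.
    by exists (z + 1); rewrite intrD; lra.
  by exists z; lra.
Qed.

Lemma spoke_and_core_derive (R : realType) (l b t : R) (i : option 'I_1) :
  derive1 (crv (spoke_and_core l b) i) t =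
  if i is Some _ then
    ((- sin (2 * pi * t) * (2 * pi), cos (2 * pi * t) * (2 * pi)), 0)
  else ((0, 0), 1 / 4).
Proof.
case: i => [i|].
  have D2 : is_derive t 1 (fun u : R => 2 * pi * u) (2 * pi).
    by apply: is_derive_eq; rewrite [LHS]mulr1.
  have [d2 e2] := derive1_is_derive D2.
  have [dc ec] := derive1_is_derive (is_derive_cos_comp d2).
  have [ds es] := derive1_is_derive (is_derive_sin_comp d2).
  have [dp ep] := derive1_pair dc ds.
  have [_ ->] := derive1_pair dp (derivable_cst b t 1).
  by rewrite ep ec es e2 derive1_cst.
have D2 : is_derive t 1 (fun u : R => l + u * (1 / 4)) (1 / 4).
  by apply: is_derive_eq; rewrite /GRing.scale /=; ring.
have [d2 e2] := derive1_is_derive D2.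
have [_ ->] := derive1_pair (derivable_cst ((1 : R), (0 : R)) t 1) d2.
by rewrite e2 derive1_cst.
Qed.

Lemma spoke_and_core_immersed (R : realType) (l b : R) : immersed (spoke_and_core l b).
Proof.
split.
- case=> [i|] /=.
    have s2 : smooth (fun u : R => 2 * pi * u).
      by apply: smoothM; [exact: smooth_cst|exact: smooth_id].
    apply: smooth_pair; last exact: smooth_cst.
    by apply: smooth_pair; [exact: smooth_cos|exact: smooth_sin].
  apply: smooth_pair; first exact: smooth_cst.
  apply: smoothD; first exact: smooth_cst.
  by apply: smoothM; [exact: smooth_id|exact: smooth_cst].
- move=> [[i|] t] _; rewrite spoke_and_core_derive; apply/eqP => E; last first.
    have : 1 / 4 = 0 :> R := congr1 snd E; lra.
  have p0 := pi_gt0 R; have pN : 2 * pi != 0 :> R by rewrite gt_eqF//; lra.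
  have E1 : - sin (2 * pi * t) * (2 * pi) = 0 := congr1 (fun v => v.1.1) E.
  have E2 : cos (2 * pi * t) * (2 * pi) = 0 := congr1 (fun v => v.1.2) E.
  move/eqP: E1; rewrite mulf_eq0 (negbTE pN) orbF oppr_eq0 => /eqP s0.
  move/eqP: E2; rewrite mulf_eq0 (negbTE pN) orbF => /eqP c0.
  have := cos2Dsin2 (2 * pi * t).
  by rewrite s0 c0 expr0n addr0 => /eqP; rewrite eq_sym oner_eq0.
- by move=> i t /=; have [-> ->] := cos_sin_turn t.
Qed.

Lemma spoke_and_core_inj (R : realType) (l b : R)
    (x y : param R (ncirc (spoke_and_core l b))) :
  ~ (l <= b <= l + 1 / 4) ->
  pdom x -> pdom y -> pt (C := spoke_and_core l b) x = pt (C := spoke_and_core l b) y ->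
  psame x y.
Proof.
move=> lb; case: x y => [[i|] t] [[j|] u] dx dy; rewrite /pt /psame /=.
- by move=> [E1 E2]; rewrite !ord1; split=> //; exact: cos_sin_turn_inj.
- by move=> [_ _ E]; case: lb; rewrite /pdom /= in dy; lra.
- by move=> [_ _ E]; case: lb; rewrite /pdom /= in dx; lra.
- by move=> [E]; split=> //; lra.
Qed.

Lemma spoke_and_core_inner (R : realType) (l b : R)
    (x : param R (ncirc (spoke_and_core l b))) :
  -1 < l -> l + 1 / 4 < 1 -> -1 < b < 1 -> pdom x ->
  inner (annulus R) (pt (C := spoke_and_core l b) x).
Proof.
move=> l1 l2 b1; case: x => [[i|] t]; rewrite /pdom /pt /= => dx.
  by split=> //=; exact: cos2Dsin2.
by split=> /=; [rewrite expr1n expr0n addr0|lra].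
Qed.

Definition plain_diagram (R : realType) (l b : R) : prediagram (R * R * R)%type :=
  PreDiagram (dcrv := spoke_and_core l b) (fun _ _ => false).

Lemma plain_diagramP (R : realType) (l b : R) :
  -1 < l -> l + 1 / 4 < 1 -> -1 < b < 1 -> ~ (l <= b <= l + 1 / 4) ->
  is_diagram (annulus R) (plain_diagram l b).
Proof.
move=> l1 l2 b1 lb.
have nd x y : ~ double_point (D := plain_diagram l b) x y.
  by move=> [dx dy nxy E]; apply: nxy; exact: spoke_and_core_inj E.
split=> //.
- exact: spoke_and_core_immersed.
- by move=> x dx; exact: spoke_and_core_inner.
- by move=> x y /nd.
- by move=> x y z /nd.
Qed.

Definition plain_knotoid (R : realType) (l b : R) : railed_curves (R * R * R)%type :=
  @RailedCurves R (R * R * R)%type ((1, 0), l) ((1, 0), l + 1 / 4)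
    (@Curves R (R * R * R * R)%type 1
      (fun i t => (crv (spoke_and_core l b) i t, 1 / 2))).

Lemma plain_knotoidP (R : realType) (l b : R) :
  -1 < l -> l + 1 / 4 < 1 -> -1 < b < 1 -> ~ (l <= b <= l + 1 / 4) ->
  is_multi_knotoid (annulus R) (plain_knotoid l b).
Proof.
move=> l1 l2 b1 lb.
have [sm dm pm] := spoke_and_core_immersed l b.
split.
- split; [| |by case; lra]; split=> /=; rewrite ?expr1n ?expr0n ?addr0//; lra.
- split=> [i|x dx|i t].
  + by apply: smooth_pair; [exact: sm|exact: smooth_cst].
  + apply/eqP => E; move/eqP: (dm x dx); apply.
    have [_ E'] := derive1_pair (smooth_derivable (t := x.2) (sm x.1))
      (derivable_cst (1 / 2 : R) x.2 1).
    by have := congr1 fst E; rewrite [in LHS]E'.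
  + by rewrite /= (cos_sin_turn t).1 (cos_sin_turn t).2.
- by move=> x y dx dy [E]; apply: (spoke_and_core_inj lb).
- by split; split=> /=; [rewrite mul0r addr0|lra|rewrite mul1r|lra].
- move=> x dx nx; have ix := spoke_and_core_inner l1 l2 b1 dx.
  split; first by split=> //=; lra.
    move=> [/= E _]; apply: nx; case: x dx ix E => [[i|] t] dx ix; rewrite /pdom /= in dx *.
      by move=> [_ _ E]; case: lb; lra.
    by move=> [E]; left; congr (_, _); lra.
  move=> [/= E _]; apply: nx; case: x dx ix E => [[i|] t] dx ix; rewrite /pdom /= in dx *.
    by move=> [_ _ E]; case: lb; lra.
  by move=> [E]; right; congr (_, _); lra.
Qed.

Lemma round_loop_continuous (R : realType) (r : R -> R) (q : R -> R) :
  continuous r -> continuous q ->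
  continuous (fun p : R * R =>
    (r p.1 * cos (2 * pi * p.2) - q p.1, r p.1 * sin (2 * pi * p.2))).
Proof.
move=> cr cq.
have c1 : continuous (fun p : R * R => p.1) by exact: continuous_fst.
have c2 : continuous (fun p : R * R => 2 * pi * p.2).
  by apply: continuousM_fun; [exact: continuous_cst|exact: continuous_snd].
have cr1 : continuous (fun p : R * R => r p.1) by exact: (continuous_after cr).
have cq1 : continuous (fun p : R * R => q p.1) by exact: (continuous_after cq).
apply: continuous_pair.
  apply: continuousB_fun => //; apply: continuousM_fun => //.
  exact: (continuous_after (@continuous_cos R)).
apply: continuousM_fun => //.
exact: (continuous_after (@continuous_sin R)).
Qed.

Lemma round_loop_neq0 (R : realType) (r q u : R) : r ^+ 2 != q ^+ 2 ->
  (r * cos (2 * pi * u) - q, r * sin (2 * pi * u)) <> 0.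
Proof.
move=> /eqP rq [E1 E2]; apply: rq.
transitivity ((r * cos (2 * pi * u)) ^+ 2 + (r * sin (2 * pi * u)) ^+ 2).
  transitivity (r ^+ 2 * (cos (2 * pi * u) ^+ 2 + sin (2 * pi * u) ^+ 2)).
    by rewrite cos2Dsin2 mulr1.
  ring.
have -> : r * cos (2 * pi * u) = q by apply/eqP; rewrite -subr_eq0 E1.
by rewrite E2 expr0n addr0.
Qed.

(** Shrinking the radius to 0 keeps the loop off the origin, since the radius stays below [q]. It
    ends at the constant loop [(- q, 0)], whose argument is the constant pi. *)
Lemma round_loop_outside (R : realType) (r q : R) : 0 <= r < q ->
  angle_lifts (fun u => (r * cos (2 * pi * u) - q, r * sin (2 * pi * u))).
Proof.
move=> rq; pose H (p : R * R) := ((r * unit_clamp p.1) * cos (2 * pi * p.2) - q,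
  (r * unit_clamp p.1) * sin (2 * pi * p.2)).
have -> : (fun u => (r * cos (2 * pi * u) - q, r * sin (2 * pi * u))) =
    (fun u => H (1, u)) by apply/funext => u; rewrite /H /= unit_clamp1 mulr1.
apply: (@angle_lifts_homotopy R H _ _ _ 0).
- apply: (round_loop_continuous (r := fun t => r * unit_clamp t) (q := fun=> q)).
    by apply: continuousM_fun; [exact: continuous_cst|exact: unit_clamp_continuous].
  exact: continuous_cst.
- by move=> s u; rewrite /H /=; have [-> ->] := cos_sin_turn u.
- move=> s u; apply: round_loop_neq0; rewrite lt_eqF//.
  have := unit_clampP s => c01.
  have c0 : 0 <= r * (1 - unit_clamp s) by apply: mulr_ge0; lra.
  have c1 : 0 <= r * unit_clamp s by apply: mulr_ge0; lra.
  by rewrite ltr_sqr ?nnegrE//; lra.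
exists (fun=> pi); split=> // [|u|u]; first exact: continuous_cst.
- by rewrite /H /= unit_clamp0 mulr0 !mul0r (sinpi R) mulr0.
- by rewrite /H /= unit_clamp0 mulr0 !mul0r (cospi R); lra.
Qed.

(** Sliding the centre to the origin gives a round loop with argument [2 * pi * u]. Its difference
    [a] from a periodic argument has positive cosine everywhere, yet grows by a full turn over one
    period and so passes through [a 0 + pi], where the cosine has the opposite sign. *)
Lemma round_loop_inside (R : realType) (r q : R) : 0 <= q < r ->
  ~ angle_lifts (fun u => (r * cos (2 * pi * u) - q, r * sin (2 * pi * u))).
Proof.
move=> qr; pose H (p : R * R) := (r * cos (2 * pi * p.2) - q * unit_clamp p.1,
  r * sin (2 * pi * p.2)).
have -> : (fun u => (r * cos (2 * pi * u) - q, r * sin (2 * pi * u))) =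
    (fun u => H (1, u)) by apply/funext => u; rewrite /H /= unit_clamp1 mulr1.
move=> /(@angle_lifts_homotopy R H _ _ _ 1 0) [].
- apply: (round_loop_continuous (r := fun=> r) (q := fun t => q * unit_clamp t)).
    exact: continuous_cst.
  by apply: continuousM_fun; [exact: continuous_cst|exact: unit_clamp_continuous].
- by move=> s u; rewrite /H /=; have [-> ->] := cos_sin_turn u.
- move=> s u; apply: round_loop_neq0; rewrite gt_eqF//.
  have := unit_clampP s => c01.
  have c0 : 0 <= q * (1 - unit_clamp s) by apply: mulr_ge0; lra.
  have c1 : 0 <= q * unit_clamp s by apply: mulr_ge0; lra.
  by rewrite ltr_sqr ?nnegrE//; lra.
move=> phi [cphi pphi tphi sphi].
pose a u := 2 * pi * u - phi u.
have ca : continuous a.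
  apply: continuousB_fun => //; apply: continuousM_fun; first exact: continuous_cst.
  exact: continuous_id.
have apos u : 0 < cos (a u).
  have r0 : 0 < r by lra.
  have := sphi u; rewrite /H /= unit_clamp0 mulr0 subr0.
  by rewrite -!mulrA -mulrDr !mulrA -cosB pmulr_rgt0.
have p0 := pi_gt0 R.
have asin u : sin (a u) = 0.
  have := tphi u; rewrite /H /= unit_clamp0 mulr0 subr0 => E.
  have rN : r != 0 by rewrite gt_eqF//; lra.
  apply: (mulfI rN); rewrite mulr0 /a sinB mulrBr !mulrA -E; ring.
have a1 : a 1 = a 0 + 2 * pi.
  by rewrite /a -[phi 1](congr1 phi (add0r 1)) pphi; ring.
have [u _ au] : exists2 u, u \in `[0, 1]%R & a u = a 0 + pi.
  apply: IVT; [exact: ler01|exact: continuous_subspaceT|].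
  by rewrite ge_min le_max a1; apply/andP; split; apply/orP; [left|right]; lra.
have := apos u; have := apos 0; rewrite au cosDpi; lra.
Qed.

(** In the ring the circle has radius [2 + b] about the origin and the leg lies at distance [2 + l]
    from it. *)
Lemma spoke_and_core_linking (R : realType) (l b : R) : -1 < l -> -1 < b ->
  (b < l -> circles_unlinked (crv (spoke_and_core l b))) /\
  (l < b -> ~ circles_unlinked (crv (spoke_and_core l b))).
Proof.
move=> l1 b1.
have E i : (fun u => planar (crv (spoke_and_core l b) (Some i) u) -
      planar (crv (spoke_and_core l b) None 0)) =
    (fun u => ((2 + b) * cos (2 * pi * u) - (2 + l), (2 + b) * sin (2 * pi * u))).
  by apply/funext => u; congr (_, _); rewrite /= mul0r addr0; ring.
split=> [bl i|lb U]; first by rewrite E; apply: round_loop_outside; lra.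
by have := U ord0; rewrite E; apply: round_loop_inside; lra.
Qed.

(** * Rotation of the torus along the meridian *)

Definition meridian_rotation (R : realType) (t : R) (x : (R * R) * (R * R)) :
    (R * R) * (R * R) :=
  (x.1, (cos (pi * t) * x.2.1 - sin (pi * t) * x.2.2,
         sin (pi * t) * x.2.1 + cos (pi * t) * x.2.2)).

Lemma meridian_rotation_continuous (R : realType) :
  continuous (fun p : R * ((R * R) * (R * R)) => meridian_rotation p.1 p.2).
Proof.
have ct : continuous (fun p : R * ((R * R) * (R * R)) => pi * p.1).
  by apply: continuousM_fun; [exact: continuous_cst|exact: continuous_fst].
have cc := continuous_after (@continuous_cos R) ct.
have cs := continuous_after (@continuous_sin R) ct.
have c2 : continuous (fun p : R * ((R * R) * (R * R)) => p.2).
  exact: continuous_snd.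
have c21 := continuous_fst_comp (continuous_snd_comp c2).
have c22 := continuous_snd_comp (continuous_snd_comp c2).
apply: continuous_pair; first exact: continuous_fst_comp.
apply: continuous_pair.
  by apply: continuousB_fun; apply: continuousM_fun.
by apply: continuousD_fun; apply: continuousM_fun.
Qed.

Lemma meridian_rotation0 (R : realType) (x : (R * R) * (R * R)) :
  meridian_rotation 0 x = x.
Proof.
case: x => z [a b]; rewrite /meridian_rotation /= mulr0 cos0 sin0.
by congr (_, (_, _)); ring.
Qed.

Lemma meridian_rotationK (R : realType) (t : R) (x : (R * R) * (R * R)) :
  meridian_rotation (- t) (meridian_rotation t x) = x.
Proof.
case: x => z [a b]; rewrite /meridian_rotation /= mulrN cosN sinN.
have := cos2Dsin2 (pi * t); move: (sin _) (cos _) => s c cs.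
congr (_, (_, _)).
  by transitivity (a * (c ^+ 2 + s ^+ 2)); [ring|rewrite cs mulr1].
by transitivity (b * (c ^+ 2 + s ^+ 2)); [ring|rewrite cs mulr1].
Qed.

Lemma meridian_rotation_torus (R : realType) (t : R) (x : (R * R) * (R * R)) :
  body (torus R) x -> body (torus R) (meridian_rotation t x).
Proof.
move=> [/= zz ab]; split=> //=.
transitivity ((cos (pi * t) ^+ 2 + sin (pi * t) ^+ 2) * (x.2.1 ^+ 2 + x.2.2 ^+ 2)).
  ring.
by rewrite ab cos2Dsin2 mulr1.
Qed.

(** The angle [pi * t] is scaled so that time [t] shifts the coordinate across the annulus by [t],
    by the addition formulas. *)
Lemma meridian_rotation_inclusion (R : realType) (z : R * R) (s t : R) :
  meridian_rotation t (inclusion (z, s)) = inclusion (z, s + t).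
Proof.
rewrite /meridian_rotation /inclusion /= mulrDr cosD sinD.
by congr (_, (_, _)); ring.
Qed.

Lemma inclusion_periodic (R : realType) (z : R * R) (s : R) :
  inclusion (z, s + 2) = inclusion (z, s).
Proof.
rewrite /inclusion /=; have -> : pi * (s + 2) = pi * s + pi *+ 2.
  by rewrite -mulr_natr; ring.
by rewrite cosD2pi sinD2pi.
Qed.

Lemma meridian_isotopy (R : realType) :
  isotopy (body (torus R)) (inner (torus R)) (@meridian_rotation R).
Proof.
apply/isotopyP; exists (fun t => meridian_rotation (- t)); split.
- by move=> x _; exact: meridian_rotation0.
- by apply: continuous_subspaceT; exact: meridian_rotation_continuous.
- apply: continuous_subspaceT.
  apply: (continuous_after (f := fun p : R * ((R * R) * (R * R)) => (- p.1, p.2))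
    (@meridian_rotation_continuous R)).
  apply: continuous_pair; last exact: continuous_snd.
  by move=> p; apply: cvgN; exact: continuous_fst.
- move=> t x _ bx; split; [exact: meridian_rotation_torus|exact: meridian_rotationK
    |exact: meridian_rotation_torus|].
  by have := meridian_rotationK (- t) x; rewrite opprK.
- by move=> t x _ bx; split; exact: meridian_rotation_torus.
Qed.

Definition thick_rotation (R : realType) (t : R) (x : ((R * R) * (R * R)) * R) :
    ((R * R) * (R * R)) * R := (meridian_rotation t x.1, x.2).

Lemma thick_meridian_isotopy (R : realType) :
  isotopy (thick (body (torus R))) (thick (inner (torus R))) (@thick_rotation R).
Proof.
have ct (f : R -> R) : continuous f -> continuous
    (fun p : R * (((R * R) * (R * R)) * R) => thick_rotation (f p.1) p.2).
  move=> cf.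
  have c2 : continuous (fun p : R * (((R * R) * (R * R)) * R) => p.2).
    exact: continuous_snd.
  apply: continuous_pair; last exact: continuous_snd_comp.
  apply: (continuous_after
    (f := fun p : R * (((R * R) * (R * R)) * R) => (f p.1, p.2.1))
    (@meridian_rotation_continuous R)).
  apply: continuous_pair; last exact: continuous_fst_comp.
  by apply: (continuous_after cf); exact: continuous_fst.
apply/isotopyP; exists (fun t => thick_rotation (- t)); split.
- by move=> -[x z] _; rewrite /thick_rotation /= meridian_rotation0.
- by apply: continuous_subspaceT; apply: (ct id); exact: continuous_id.
- apply: continuous_subspaceT; apply: (ct (fun t => - t)) => t.
  by apply: cvgN; exact: cvg_id.
- move=> t [x z] _ [bx z01]; have := meridian_rotationK (- t) x.
  rewrite opprK /thick_rotation /= meridian_rotationK => ->.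
  by split=> //; split=> //=; exact: meridian_rotation_torus.
- move=> t [x z] _ [bx z01].
  by split; split=> //=; exact: meridian_rotation_torus.
Qed.

Lemma reparam_id (R : realType) (k : nat) :
  @reparam R k k id (fun _ => id).
Proof.
split=> //; first by split=> //; exists id.
  by move=> i; split=> // x; exact: cvg_id.
by move=> i; exists false => t; rewrite expr0.
Qed.

(** The shift by 1 sends the spoke from -3/4 to 1/4 directly and the circle from 1/2 to 3/2, which
    agrees with -1/2 modulo the period 2. *)
Lemma rotate_spoke_and_core (R : realType) (i : option 'I_1) (t : R) :
  inclusion (crv (spoke_and_core (1 / 4) (- (1 / 2))) i t) =
  meridian_rotation 1 (inclusion (crv (spoke_and_core (- (3 / 4)) (1 / 2)) i t)).
Proof.
case: i => [i|] /=; rewrite meridian_rotation_inclusion.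
  by rewrite -inclusion_periodic; congr (inclusion (_, _)); lra.
by congr (inclusion (_, _)); lra.
Qed.

Theorem proposition4p12 (R : realType) :
  (exists mu : K_surface (annulus R) -> K_surface (torus R),
     (forall D : diagram (annulus R), exists D' : diagram (torus R),
        sval D' = map_diagram (@inclusion R) (sval D) /\
        mu (diagram_class D) = diagram_class D') /\
     ~ injective mu) /\
  (exists mu : K_thick (annulus R) -> K_thick (torus R),
     (forall K : multi_knotoid (annulus R), exists K' : multi_knotoid (torus R),
        sval K' =
          map_railed (@inclusion R) (@thick_inclusion R) (sval K) /\
        mu (knotoid_class K) = knotoid_class K') /\
     ~ injective mu).
Proof.
(* In both pictures the level of the circle avoids the spoke, so there are no crossings. *)
have n1 : ~ (- (3 / 4) <= (1 / 2 : R) <= - (3 / 4) + 1 / 4) by lra.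
have n2 : ~ (1 / 4 <= (- (1 / 2) : R) <= 1 / 4 + 1 / 4) by lra.
have [_ linked] :=
  @spoke_and_core_linking R (- (3 / 4)) (1 / 2) ltac:(lra) ltac:(lra).
have [unlinked _] :=
  @spoke_and_core_linking R (1 / 4) (- (1 / 2)) ltac:(lra) ltac:(lra).
split.
- pose F (D : diagram (annulus R)) : diagram (torus R) :=
    exist _ (map_diagram (@inclusion R) (sval D)) (is_diagram_inclusion (proj2_sig D)).
  have [mu muE] := classes_map (e := @diagram_move R _ (annulus R))
    (e' := @diagram_move R _ (torus R)) (F := F)
    (fun D D' => diagram_move_inclusion (E := F D) (E' := F D') erefl erefl).
  exists mu; split=> [D|]; first by exists (F D); split=> //; exact: muE.
  pose D1 : diagram (annulus R) := exist _ _
    (@plain_diagramP R (- (3 / 4)) (1 / 2) ltac:(lra) ltac:(lra) ltac:(lra) n1).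
  pose D2 : diagram (annulus R) := exist _ _
    (@plain_diagramP R (1 / 4) (- (1 / 2)) ltac:(lra) ltac:(lra) ltac:(lra) n2).
  move=> inj; have /inj : mu (diagram_class D1) = mu (diagram_class D2).
    rewrite /diagram_class !muE; apply: class_of_eq; apply: rst_step.
    (* The two images in the torus differ by a single isotopy move, the half turn. *)
    apply: Move_isotopy; exists (@meridian_rotation R), id, (fun _ => id).
    split=> [| |x _|//]; [exact: meridian_isotopy|exact: reparam_id|].
    exact: rotate_spoke_and_core.
  (* Injectivity would make the two annular diagrams equivalent, and [D1] would inherit from [D2]
     that its circle does not wind around the leg. *)
  move=> /(classes_invariant (@diagram_move_unlinked R))[_ U].
  exact: linked ltac:(lra) (U (unlinked ltac:(lra))).
pose F (K : multi_knotoid (annulus R)) : multi_knotoid (torus R) :=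
  exist _ (map_railed (@inclusion R) (@thick_inclusion R) (sval K))
    (is_multi_knotoid_inclusion (proj2_sig K)).
have [mu muE] := classes_map (e := @rail_move R _ (annulus R))
  (e' := @rail_move R _ (torus R)) (F := F)
  (fun K K' => rail_move_inclusion (L := F K) (L' := F K') erefl erefl).
exists mu; split=> [K|]; first by exists (F K); split=> //; exact: muE.
pose K1 : multi_knotoid (annulus R) := exist _ _
  (@plain_knotoidP R (- (3 / 4)) (1 / 2) ltac:(lra) ltac:(lra) ltac:(lra) n1).
pose K2 : multi_knotoid (annulus R) := exist _ _
  (@plain_knotoidP R (1 / 4) (- (1 / 2)) ltac:(lra) ltac:(lra) ltac:(lra) n2).
move=> inj; have /inj : mu (knotoid_class K1) = mu (knotoid_class K2).
  rewrite /knotoid_class !muE; apply: class_of_eq; apply: rst_step.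
  (* The rotation carries the rails along, so it is a rail shift; the two witnesses that follow are
     the paths of the leg rail and of the head rail. *)
  apply: Move_rail_shift; exists (@thick_rotation R).
  exists (fun t => meridian_rotation t (inclusion ((1, 0), - (3 / 4)))).
  exists (fun t => meridian_rotation t (inclusion ((1, 0), - (3 / 4) + 1 / 4))).
  have rot (p : (R * R) * (R * R)) (t : R) :
      thick_rotation t @` rail p = rail (meridian_rotation t p).
    apply/seteqP; split=> [_ [[x z] [/= -> z01] <-]|[x z] [/= -> z01]] //.
    by exists (p, z).
  split=> [|t _||].
  - exact: thick_meridian_isotopy.
  - by split; exact: rot.
  - by split=> /=; rewrite meridian_rotation_inclusion; congr (inclusion (_, _)); lra.
  - exists id, (fun _ => id); split=> [|[i t] _]; first exact: reparam_id.
    by congr (_, _); exact: rotate_spoke_and_core.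
move=> /(classes_invariant (@rail_move_unlinked R))[_ U].
exact: linked ltac:(lra) (U (unlinked ltac:(lra))).
Qed.
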